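(* Every connected locally finite graph $G$ without thick ends has a canonical tree-decomposition which efficiently distinguishes all the tangles in $G$.
   Context: Graphs may be infinite; a graph is locally finite if every vertex has finitely many neighbours. An end of $G$ is an equivalence class of rays, two rays being equivalent if no finite vertex set separates them; an end is thick if it contains infinitely many pairwise disjoint rays. A separation of $G$ is an unordered pair $\{A,B\}$ of subsets of $V(G)$ with $A\cup B=V(G)$ such that no edge of $G$ joins $A\setminus B$ to $B\setminus A$; its order is $|A\cap B|$. Its two orientations are the ordered pairs $(A,B)$ and $(B,A)$ (oriented separations), partially ordered by $(A,B)\le (C,D)$ iff $A\subseteq C$ and $B\supseteq D$. A set $O$ of oriented separations is consistent if there are no $(A,B),(C,D)\in O$ with $\{A,B\}\neq\{C,D\}$ and $(B,A)\le (C,D)$. A pre-tangle in $G$ is a set $P$ for which there is $k\in\mathbb N\cup\{\aleph_0\}$ such that $P$ contains exactly one orientation of each separation of $G$ of order less than $k$ (and nothing else) and $P$ is consistent. A tangle is a pre-tangle $P$ such that for any three (not necessarily distinct) $(A_1,B_1),(A_2,B_2),(A_3,B_3)\in P$ we have $G[A_1]\cup G[A_2]\cup G[A_3]\neq G$. A separation distinguishes two tangles if each contains an orientation of it but they contain different orientations; it does so efficiently if it has minimum order among all separations distinguishing them. Two tangles are distinguishable if some separation distinguishes them. A tree-decomposition $(T,\mathcal V)$ efficiently distinguishes all tangles of $G$ if for every two distinguishable tangles there is a separation of $G$ induced by an edge of $T$ (in the usual way) that efficiently distinguishes them. It is canonical if it is invariant under the automorphisms of $G$, i.e. the automorphism group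 of $G$ acts naturally on it. *)

(* Defs.v *)
From Stdlib Require Import List Arith.
Import ListNotations.

Section Graphs.
Context {V : Type}.

Definition set_eq (A B : V -> Prop) : Prop := forall x, A x <-> B x.
Definition subset (A B : V -> Prop) : Prop := forall x, A x -> B x.
Definition finite_set (S : V -> Prop) : Prop := exists l : list V, forall x, S x -> In x l.
Definition has_size (S : V -> Prop) (n : nat) : Prop :=
  exists l : list V, NoDup l /\ (forall x, S x <-> In x l) /\ length l = n.

End Graphs.

Fixpoint chain {X : Type} (R : X -> X -> Prop) (x : X) (l : list X) : Prop :=
  match l with
  | [] => True
  | y :: l' => R x y /\ chain R y l'
  end.

Section SimpleGraph.
Context {V : Type} (adj : V -> V -> Prop).

Definition simple_graph : Prop :=
  (forall u v, adj u v -> adj v u) /\ (forall v, ~ adj v v).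

Definition locally_finite : Prop :=
  forall v, exists l : list V, forall u, adj v u -> In u l.

Definition connected_graph : Prop :=
  inhabited V /\
  forall u v, exists l : list V, chain adj u l /\ last l u = v.

Definition is_ray (r : nat -> V) : Prop :=
  (forall i j, r i = r j -> i = j) /\ (forall n, adj (r n) (r (S n))).

Definition ray_equiv (r1 r2 : nat -> V) : Prop :=
  forall S : V -> Prop, finite_set S ->
    exists n m,
      (forall k, n <= k -> ~ S (r1 k)) /\
      (forall k, m <= k -> ~ S (r2 k)) /\
      exists l : list V, chain adj (r1 n) l /\ last l (r1 n) = r2 m /\
                         (forall x, In x (r1 n :: l) -> ~ S x).

(* G has a thick end: some end (the class of a ray r) contains infinitely many
   pairwise disjoint rays *)
Definition has_thick_end : Prop :=
  exists r : nat -> V, is_ray r /\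
  exists R : nat -> nat -> V,
    (forall i, is_ray (R i)) /\
    (forall i, ray_equiv (R i) r) /\
    (forall i j, i <> j -> forall a b, R i a <> R j b).

Definition is_separation (A B : V -> Prop) : Prop :=
  (forall v, A v \/ B v) /\
  (forall u v, adj u v -> A u -> ~ B u -> B v -> ~ A v -> False).

Definition sep_inter (A B : V -> Prop) : V -> Prop := fun x => A x /\ B x.

(* order of {A,B} is less than k, k in N \cup {aleph_0} (None = aleph_0) *)
Definition order_lt (A B : V -> Prop) (k : option nat) : Prop :=
  match k with
  | Some n => exists m, has_size (sep_inter A B) m /\ m < n
  | None => finite_set (sep_inter A B)
  end.

Definition sep_eq (A B C D : V -> Prop) : Prop :=
  (set_eq A C /\ set_eq B D) \/ (set_eq A D /\ set_eq B C).

(* sets of oriented separations: P A B means (A,B) \in P *)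
Definition consistent (P : (V -> Prop) -> (V -> Prop) -> Prop) : Prop :=
  forall A B C D, P A B -> P C D -> ~ sep_eq A B C D ->
    ~ (subset B C /\ subset D A).

Definition pre_tangle (P : (V -> Prop) -> (V -> Prop) -> Prop) : Prop :=
  exists k : option nat,
    (forall A B, P A B -> is_separation A B /\ order_lt A B k) /\
    (forall A B, is_separation A B -> order_lt A B k -> P A B \/ P B A) /\
    (forall A B, P A B -> P B A -> set_eq A B) /\
    consistent P.

(* G[A1] \cup G[A2] \cup G[A3] = G *)
Definition covers3 (A1 A2 A3 : V -> Prop) : Prop :=
  (forall v, A1 v \/ A2 v \/ A3 v) /\
  (forall u v, adj u v ->
     (A1 u /\ A1 v) \/ (A2 u /\ A2 v) \/ (A3 u /\ A3 v)).

Definition tangle (P : (V -> Prop) -> (V -> Prop) -> Prop) : Prop :=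
  pre_tangle P /\
  forall A1 B1 A2 B2 A3 B3, P A1 B1 -> P A2 B2 -> P A3 B3 -> ~ covers3 A1 A2 A3.

Definition distinguishes (P Q : (V -> Prop) -> (V -> Prop) -> Prop) (A B : V -> Prop) : Prop :=
  (P A B /\ Q B A) \/ (P B A /\ Q A B).

Definition distinguishable (P Q : (V -> Prop) -> (V -> Prop) -> Prop) : Prop :=
  exists A B, distinguishes P Q A B.

Definition efficiently_distinguishes (P Q : (V -> Prop) -> (V -> Prop) -> Prop)
  (A B : V -> Prop) : Prop :=
  distinguishes P Q A B /\
  exists n, has_size (sep_inter A B) n /\
    forall C D m, distinguishes P Q C D -> has_size (sep_inter C D) m -> n <= m.

Definition graph_automorphism (phi : V -> V) : Prop :=
  (forall x y, phi x = phi y -> x = y) /\ (forall y, exists x, phi x = y) /\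
  (forall u v, adj u v <-> adj (phi u) (phi v)).

End SimpleGraph.

Section Trees.
Context {N : Type} (tadj : N -> N -> Prop).

Definition is_tree : Prop :=
  (forall s t, tadj s t -> tadj t s) /\ (forall t, ~ tadj t t) /\
  (forall s t, exists l : list N, chain tadj s l /\ last l s = t) /\
  ~ (exists x l, chain tadj x l /\ NoDup (x :: l) /\ 2 <= length l /\
                 tadj (last l x) x).

Definition on_tree_path (t1 t2 t3 : N) : Prop :=
  exists l, chain tadj t1 l /\ NoDup (t1 :: l) /\ last l t1 = t3 /\ In t2 (t1 :: l).

(* s lies in the component of T - t2 containing t1; for an edge t1 t2 this is
   the side of t1 in T - t1t2 *)
Definition tree_side (t1 t2 s : N) : Prop :=
  exists l, chain tadj t1 l /\ last l t1 = s /\ ~ In t2 (t1 :: l).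

Definition tree_automorphism (psi : N -> N) : Prop :=
  (forall x y, psi x = psi y -> x = y) /\ (forall y, exists x, psi x = y) /\
  (forall s t, tadj s t <-> tadj (psi s) (psi t)).

End Trees.

Section TreeDecomposition.
Context {V N : Type} (adj : V -> V -> Prop) (tadj : N -> N -> Prop) (bag : N -> V -> Prop).

Definition tree_decomposition : Prop :=
  is_tree tadj /\
  (forall v, exists t, bag t v) /\
  (forall u v, adj u v -> exists t, bag t u /\ bag t v) /\
  (forall t1 t2 t3, on_tree_path tadj t1 t2 t3 -> subset (sep_inter (bag t1) (bag t3)) (bag t2)).

Definition edge_side (t1 t2 : N) : V -> Prop :=
  fun v => exists s, tree_side tadj t1 t2 s /\ bag s v.

Definition td_efficiently_distinguishes_all_tangles : Prop :=
  forall P Q, tangle adj P -> tangle adj Q -> distinguishable P Q ->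
    exists t1 t2, tadj t1 t2 /\
      efficiently_distinguishes P Q (edge_side t1 t2) (edge_side t2 t1).

Definition td_canonical : Prop :=
  exists act : (V -> V) -> N -> N,
    (forall phi, graph_automorphism adj phi ->
       tree_automorphism tadj (act phi) /\
       (forall t v, bag t v <-> bag (act phi t) (phi v))) /\
    (forall t, act (fun x => x) t = t) /\
    (forall phi phi', graph_automorphism adj phi -> graph_automorphism adj phi' ->
       forall t, act (fun x => phi (phi' x)) t = act phi (act phi' t)).

End TreeDecomposition.

(* Main.v *)
(* Among the separations that efficiently distinguish two given tangles, a canonical nested set [N]
   is chosen order by order: of those nested with the previous choices, take the ones that cross
   the fewest efficient distinguishers of the same order. Such crossing numbers are finite because
   the separators are tight, and submodularity applied to corners shows that [N] is nested and
   distinguishes all distinguishable tangles.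

   [N] is the edge set of a tree provided that every ascending chain in [N] whose members all have
   a fixed vertex strictly on their upper side has a maximal element. Tightness allows only
   finitely many members of each order, so along a chain without one the orders grow; at the
   members after which only larger orders occur, the tangles below agree more and more and
   converge to an end. No finite set smaller than the order of such a member separates it from
   this end, which therefore contains infinitely many disjoint rays. The rays are orbits of an
   injection [g] with [g x] equal or adjacent to [x], found by a Hall-type form of Menger's
   theorem. *)

From Stdlib Require Import List Arith Lia FinFun Classical ClassicalEpsilon.
From Stdlib Require Import FunctionalExtensionality PropExtensionality.
Require Import Defs.
Import ListNotations.

(** * Finite sets *)

(** Orders are treated increasingly because a separation can be uncrossed from one of smaller order
    without losing efficiency: if both useful corners were too large, the corners opposite to them
    would fall below the smaller order, which the efficiency of the smaller separation forbids.
    Equal orders give no such preference; there the finite crossing number decides. All minimisers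
    are kept, since selecting one would break invariance under automorphisms. The obstacle is that a
    nested set need not be the edge set of a tree: infinitely many members may lie between two given
    ones, and a vertex may be left behind by an infinite chain and lie in no bag. The condition on
    maximal elements excludes both, applied to chains and to the inverses of their members. It is
    stated for two vertices because the ends of an edge of the graph must share a bag. *)

Lemma set_ext {T} (A B : T -> Prop) : (forall x, A x <-> B x) -> A = B.
Proof.
  intros H. apply functional_extensionality. intros x.
  apply propositional_extensionality, H.
Qed.

Definition ind {T} (S : T -> Prop) (x : T) : nat :=
  if excluded_middle_informative (S x) then 1 else 0.

Definition cnt {T} (S : T -> Prop) (L : list T) : nat := list_sum (map (ind S) L).

Lemma ind_in {T} (S : T -> Prop) x : S x -> ind S x = 1.
Proof. intros H. unfold ind. destruct excluded_middle_informative; tauto. Qed.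

Lemma ind_out {T} (S : T -> Prop) x : ~ S x -> ind S x = 0.
Proof. intros H. unfold ind. destruct excluded_middle_informative; tauto. Qed.

Definition cfilter {T} (S : T -> Prop) (L : list T) : list T :=
  filter (fun x => if excluded_middle_informative (S x) then true else false) L.

Lemma in_cfilter {T} (S : T -> Prop) L x : In x (cfilter S L) <-> In x L /\ S x.
Proof.
  unfold cfilter. rewrite filter_In.
  destruct excluded_middle_informative; intuition discriminate.
Qed.

Lemma length_cfilter {T} (S : T -> Prop) L : length (cfilter S L) = cnt S L.
Proof.
  induction L as [|x L IH]; [reflexivity|].
  unfold cnt, cfilter in *. simpl. unfold ind at 1.
  destruct excluded_middle_informative; simpl; lia.
Qed.

Lemma finite_nodup {T} (S : T -> Prop) :
  finite_set S -> exists L, NoDup L /\ forall x, S x <-> In x L.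
Proof.
  intros [l Hl].
  assert (D : forall x y : T, {x = y} + {x <> y})
    by (intros; apply excluded_middle_informative).
  exists (cfilter S (nodup D l)). split.
  - apply NoDup_filter, NoDup_nodup.
  - intros x. rewrite in_cfilter, nodup_In. firstorder.
Qed.

Lemma finite_has_size {T} (S : T -> Prop) : finite_set S -> exists n, has_size S n.
Proof.
  intros H. destruct (finite_nodup S H) as [L [H1 H2]].
  exists (length L), L. auto.
Qed.

Lemma has_size_finite {T} (S : T -> Prop) n : has_size S n -> finite_set S.
Proof. intros [L [_ [H _]]]. exists L. firstorder. Qed.

Lemma finite_subset {T} (S S' : T -> Prop) :
  finite_set S' -> (forall x, S x -> S' x) -> finite_set S.
Proof. intros [l H] H1. exists l. firstorder. Qed.

Lemma finite_union {T} (S S' : T -> Prop) :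
  finite_set S -> finite_set S' -> finite_set (fun x => S x \/ S' x).
Proof.
  intros [l H] [l' H']. exists (l ++ l'). intros x Hx. apply in_or_app. firstorder.
Qed.

Lemma has_size_inj {T U} (S : T -> Prop) (S' : U -> Prop) (f : T -> U) n m :
  has_size S n -> has_size S' m ->
  (forall x, S x -> S' (f x)) ->
  (forall x y, S x -> S y -> f x = f y -> x = y) -> n <= m.
Proof.
  intros [L [H1 [H2 <-]]] [L' [H1' [H2' <-]]] Hf Hi.
  rewrite <- (length_map f L). apply NoDup_incl_length.
  - clear L' H1' H2' Hf.
    assert (Hi' : forall x y, In x L -> In y L -> f x = f y -> x = y)
      by (intros; apply Hi; firstorder).
    clear H2 Hi S. induction H1 as [|x L Hx H1 IH]; simpl; constructor.
    + intros H. apply in_map_iff in H. destruct H as [y [E Hy]].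
      apply Hx. rewrite <- (Hi' y x); simpl; auto.
    + apply IH. intros; apply Hi'; simpl; auto.
  - intros y Hy. apply in_map_iff in Hy. destruct Hy as [x [<- Hx]].
    apply H2', Hf, H2, Hx.
Qed.

Lemma has_size_subset {T} (S S' : T -> Prop) n m :
  has_size S n -> has_size S' m -> (forall x, S x -> S' x) -> n <= m.
Proof. intros H H' Hs. apply (has_size_inj S S' (fun x => x) n m); auto. Qed.

Lemma has_size_unique {T} (S : T -> Prop) n m : has_size S n -> has_size S m -> n = m.
Proof. intros H H'. apply Nat.le_antisymm; eapply has_size_subset; eauto. Qed.

Lemma has_size_cnt {T} (S : T -> Prop) n L :
  has_size S n -> NoDup L -> (forall x, S x -> In x L) -> cnt S L = n.
Proof.
  intros H HL HS. eapply has_size_unique; [|apply H].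
  exists (cfilter S L). split; [apply NoDup_filter, HL|]. split.
  - intros x. rewrite in_cfilter. firstorder.
  - apply length_cfilter.
Qed.

Lemma has_size_empty {T} (S : T -> Prop) : (forall x, ~ S x) -> has_size S 0.
Proof. intros H. exists []. split; [constructor|]. firstorder. Qed.

Lemma has_size_0 {T} (S : T -> Prop) : has_size S 0 -> forall x, ~ S x.
Proof. intros [[|a L] [_ [H E]]] x Hx; [firstorder|discriminate]. Qed.

Lemma has_size_pos {T} (S : T -> Prop) n : has_size S n -> 0 < n -> exists x, S x.
Proof. intros [[|a L] [_ [H E]]] Hn; simpl in *; [lia|]. exists a. apply H. auto. Qed.

Section FourSets.
Context {T : Type} (a b c d : T -> Prop) (na nb nc nd : nat).
Context (Ha : has_size a na) (Hb : has_size b nb) (Hc : has_size c nc) (Hd : has_size d nd).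
Context (Hac : forall x, a x -> c x \/ d x) (Hbc : forall x, b x -> c x \/ d x).
Context (Hab : forall x, a x -> b x -> c x /\ d x).

Lemma ind_four x : ind a x + ind b x <= ind c x + ind d x.
Proof.
  specialize (Hac x). specialize (Hbc x). specialize (Hab x).
  unfold ind. repeat destruct excluded_middle_informative; simpl; try lia; tauto.
Qed.

Lemma four_cover : exists L, NoDup L /\ forall x, (c x \/ d x) <-> In x L.
Proof.
  apply finite_nodup, finite_union; eapply has_size_finite; eauto.
Qed.

(** The indicator inequality [ind_four] is summed over one list covering all sets. With
    [fun _ => False] for some of them it also serves to add and compare cardinalities. *)
Lemma has_size_four : na + nb <= nc + nd.
Proof.
  destruct four_cover as [L [HL HI]].
  rewrite <- (has_size_cnt a na L), <- (has_size_cnt b nb L),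
    <- (has_size_cnt c nc L), <- (has_size_cnt d nd L); auto;
    try (intros x Hx; apply HI; auto; fail).
  clear HL HI. unfold cnt. induction L as [|x L IH]; simpl; [lia|].
  pose proof (ind_four x). lia.
Qed.

Lemma has_size_four_lt x0 : (c x0 \/ d x0) -> ~ a x0 -> ~ b x0 -> na + nb < nc + nd.
Proof.
  intros H0 H1 H2.
  destruct four_cover as [L [HL HI]].
  rewrite <- (has_size_cnt a na L), <- (has_size_cnt b nb L),
    <- (has_size_cnt c nc L), <- (has_size_cnt d nd L); auto;
    try (intros x Hx; apply HI; auto; fail).
  assert (Hin : In x0 L) by (apply HI; auto). clear HL HI.
  assert (W : forall L', cnt a L' + cnt b L' <= cnt c L' + cnt d L').
  { unfold cnt. induction L' as [|x L' IH]; simpl; [lia|].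
    pose proof (ind_four x). lia. }
  assert (W0 : ind a x0 + ind b x0 < ind c x0 + ind d x0).
  { rewrite (ind_out a), (ind_out b) by auto.
    destruct H0 as [H0|H0]; [rewrite (ind_in c)|rewrite (ind_in d)]; auto; lia. }
  unfold cnt in *. induction L as [|x L IH]; simpl; [destruct Hin|].
  destruct Hin as [->|Hin].
  - specialize (W L). lia.
  - specialize (IH Hin). pose proof (ind_four x). lia.
Qed.

End FourSets.

Lemma finite_inj {T U} (S : T -> Prop) (S' : U -> Prop) (f : T -> U) :
  finite_set S' -> (forall x, S x -> S' (f x)) ->
  (forall x y, S x -> S y -> f x = f y -> x = y) -> finite_set S.
Proof.
  intros [l Hl] Hf Hi.
  assert (H : forall x, S x -> In (f x) l) by auto. clear Hl Hf.
  revert S H Hi. induction l as [|u l IH]; intros S H Hi.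
  - exists []. intros x Hx. destruct (H x Hx).
  - destruct (IH (fun x => S x /\ f x <> u)) as [l1 H1].
    + intros x [Hx Hu]. destruct (H x Hx); [congruence|auto].
    + firstorder.
    + destruct (classic (exists x, S x /\ f x = u)) as [[x0 [Hx0 E]]|N].
      * exists (x0 :: l1). intros x Hx. destruct (classic (f x = u)) as [E'|E'].
        -- left. apply Hi; auto; congruence.
        -- right. auto.
      * exists l1. intros x Hx. apply H1. split; auto. intros E. apply N. eauto.
Qed.

Lemma finite_bounded_union {T U} (S : U -> Prop) (F : U -> T -> Prop) :
  finite_set S -> (forall u, S u -> finite_set (F u)) ->
  finite_set (fun x => exists u, S u /\ F u x).
Proof.
  intros [l Hl] HF.
  assert (H : forall l' : list U, finite_set (fun x => exists u, In u l' /\ S u /\ F u x)).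
  { induction l' as [|u l' [l1 H1]].
    - exists []. firstorder.
    - destruct (classic (S u)) as [Hu|Hu].
      + destruct (HF u Hu) as [l2 H2]. exists (l1 ++ l2). intros x [w [[->|Hw] Hx]];
          apply in_or_app; [right; apply H2; tauto|left; apply H1; eauto].
      + exists l1. intros x [w [[->|Hw] Hx]]; [tauto|apply H1; eauto]. }
  destruct (H l) as [l' Hl']. exists l'. intros x [u [Hu Hx]]. apply Hl'. eauto.
Qed.

Lemma finite_powerset {T} (Z : T -> Prop) :
  finite_set Z -> finite_set (fun X : T -> Prop => forall x, X x -> Z x).
Proof.
  intros [l Hl].
  assert (H : finite_set (fun X : T -> Prop => forall x, X x -> In x l)).
  { clear Z Hl. induction l as [|a l [L HL]].
    - exists [fun _ => False]. intros X HX. left. apply set_ext. firstorder.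
    - exists (L ++ map (fun X x => X x \/ x = a) L). intros X HX.
      apply in_or_app. destruct (classic (X a)) as [Ha|Ha].
      + right. apply in_map_iff. exists (fun x => X x /\ x <> a). split.
        * apply set_ext. intros x. destruct (classic (x = a)) as [->|E]; tauto.
        * apply HL. intros x [Hx E]. destruct (HX x Hx); [congruence|auto].
      + left. apply HL. intros x Hx. destruct (HX x Hx); [congruence|auto]. }
  eapply finite_subset; [exact H|]. simpl. intros X HX x Hx. auto.
Qed.

Lemma finite_maximal {T} (le : T -> T -> Prop) (S : T -> Prop) x0 :
  (forall x y z, le x y -> le y z -> le x z) -> (forall x y, le x y -> le y x -> x = y) ->
  finite_set S -> S x0 -> exists m, S m /\ forall y, S y -> le m y -> y = m.
Proof.
  intros Htr Has [l Hl] H0. revert S x0 H0 Hl. induction l as [|a l IH]; intros S x0 H0 Hl.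
  - destruct (Hl x0 H0).
  - destruct (classic (exists x, S x /\ x <> a)) as [[x1 [H1 E1]]|N].
    + destruct (IH (fun x => S x /\ x <> a) x1) as [m [[Hm Em] Hmax]].
      * auto.
      * intros x [Hx E]. destruct (Hl x Hx); [congruence|auto].
      * destruct (classic (S a /\ le m a)) as [[Ha Hle]|N].
        -- exists a. split; auto. intros y Hy Hay.
           destruct (classic (y = a)) as [E|E]; auto.
           assert (y = m) by (apply Hmax; eauto). subst y. apply Has; auto.
        -- exists m. split; auto. intros y Hy Hmy.
           destruct (classic (y = a)) as [->|E]; [tauto|]. apply Hmax; auto.
    + assert (E : forall x, S x -> x = a)
        by (intros x Hx; apply NNPP; intros E; apply N; eauto).
      exists x0. split; auto. intros y Hy _. rewrite (E y Hy), (E x0 H0). auto.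
Qed.

Lemma least_nat (P : nat -> Prop) n : P n -> exists m, P m /\ forall k, P k -> m <= k.
Proof.
  revert P. induction n as [n IH] using lt_wf_ind; intros P Hn.
  destruct (classic (exists k, P k /\ k < n)) as [[k [Hk Hlt]]|N].
  - apply (IH k Hlt P Hk).
  - exists n. split; auto. intros k Hk. destruct (le_lt_dec n k); auto. exfalso; eauto.
Qed.

Lemma infinite_sequence {T} (S : T -> Prop) :
  ~ finite_set S -> exists f : nat -> T, (forall n, S (f n)) /\ (forall i j, f i = f j -> i = j).
Proof.
  intros H.
  assert (C : forall l : list T, exists x, S x /\ ~ In x l).
  { intros l. apply NNPP. intros N. apply H. exists l. intros x Hx.
    apply NNPP. intros N'. apply N. eauto. }
  destruct (choice _ C) as [g Hg].
  pose (L := fix L n := match n with 0 => [] | S n => g (L n) :: L n end).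
  assert (HL : forall i j, i < j -> In (g (L i)) (L j)).
  { intros i j Hij. induction Hij; simpl; auto. }
  exists (fun n => g (L n)). split; [intros; apply Hg|].
  intros i j E. destruct (lt_eq_lt_dec i j) as [[Hlt|Heq]|Hgt]; auto; exfalso.
  - apply (proj2 (Hg (L j))). rewrite <- E. auto.
  - apply (proj2 (Hg (L i))). rewrite E. auto.
Qed.

Lemma injective_sequence_escapes {T} (f : nat -> T) (L : list T) :
  (forall i j, f i = f j -> i = j) -> exists n, ~ In (f n) L.
Proof.
  intros Hi. apply NNPP. intros N.
  assert (H : forall n, In (f n) L) by (intros n; apply NNPP; eauto).
  assert (length (map f (seq 0 (S (length L)))) <= length L).
  { apply NoDup_incl_length.
    - apply Injective_map_NoDup; [exact Hi|apply seq_NoDup].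
    - intros x Hx. apply in_map_iff in Hx. destruct Hx as [n [<- _]]. auto. }
  rewrite length_map, length_seq in *. lia.
Qed.

(** * Walks *)

Section Reach.
Context {V : Type} (adj : V -> V -> Prop).

Inductive reach (Q : V -> Prop) : V -> V -> Prop :=
| reach_refl x : Q x -> reach Q x x
| reach_step x y z : Q x -> adj x y -> reach Q y z -> reach Q x z.

Lemma reach_source Q x y : reach Q x y -> Q x.
Proof. destruct 1; auto. Qed.

Lemma reach_target Q x y : reach Q x y -> Q y.
Proof. induction 1; auto. Qed.

Lemma reach_trans Q x y z : reach Q x y -> reach Q y z -> reach Q x z.
Proof. induction 1; auto. intros. econstructor; eauto. Qed.

Lemma reach_mono (Q Q' : V -> Prop) x y :
  (forall z, Q z -> Q' z) -> reach Q x y -> reach Q' x y.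
Proof. intros H. induction 1; [constructor|econstructor]; eauto. Qed.

Lemma reach_edge (Q : V -> Prop) x y : Q x -> Q y -> adj x y -> reach Q x y.
Proof. intros. econstructor; eauto. constructor; auto. Qed.

Lemma reach_sym Q x y : (forall u v, adj u v -> adj v u) -> reach Q x y -> reach Q y x.
Proof.
  intros Hs. induction 1 as [|x y z Hx Hxy Hr IH]; [constructor; auto|].
  apply reach_trans with y; [exact IH|].
  apply reach_edge; auto. eapply reach_source; eauto.
Qed.

(** Every vertex of the walk is itself reachable from its start, so walks in a component stay in
    it. *)
Lemma reach_within Q x y : reach Q x y -> reach (fun z => reach Q x z) x y.
Proof.
  intros H. assert (G : forall w, reach Q w y -> reach Q x w -> reach (fun z => reach Q x z) w y).
  { induction 1 as [w Hw|w u z Hw Hwu Hr IH]; intros Hxw; [constructor; auto|].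
    apply reach_step with u; [exact Hxw|exact Hwu|].
    apply IH; auto. apply reach_trans with w; [exact Hxw|].
    apply reach_edge; auto. eapply reach_source; eauto. }
  apply G; auto. constructor. eapply reach_source; eauto.
Qed.

Lemma last_cons_default {T} (l : list T) a b : last (a :: l) b = last l a.
Proof.
  revert a b. induction l as [|c l IH]; intros a b; [reflexivity|].
  change (last (c :: l) b = last (c :: l) a). now rewrite !IH.
Qed.

Lemma reach_chain Q x y :
  reach Q x y <-> exists l, chain adj x l /\ last l x = y /\ forall z, In z (x :: l) -> Q z.
Proof.
  split.
  - induction 1 as [x Hx|x y z Hx Hxy Hr [l [H1 [H2 H3]]]].
    + exists []. simpl. intuition congruence.
    + exists (y :: l). simpl chain. rewrite last_cons_default. split; [auto|]. split; [auto|].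
      intros w [<-|Hw]; auto.
  - intros [l [H1 [H2 H3]]]. revert x H1 H2 H3.
    induction l as [|a l IH]; intros x H1 H2 H3.
    + simpl in H2. subst. constructor. apply H3. simpl; auto.
    + destruct H1 as [Hxa H1]. rewrite last_cons_default in H2.
      econstructor; [|eauto|]; [apply H3; simpl; auto|]. apply IH; auto.
      intros z Hz. apply H3. right. auto.
Qed.

Lemma reach_finite Q x y :
  reach Q x y -> exists Z, finite_set Z /\ (forall z, Z z -> Q z) /\ reach Z x y.
Proof.
  intros H. apply reach_chain in H. destruct H as [l [H1 [H2 H3]]].
  exists (fun z => In z (x :: l)). split; [exists (x :: l); auto|]. split; auto.
  apply reach_chain. eauto.
Qed.

Lemma reach_exit Q (W : V -> Prop) x y :
  reach Q x y -> W x -> ~ W y ->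
  exists u v, reach (fun z => Q z /\ W z) x u /\ adj u v /\ Q v /\ ~ W v.
Proof.
  induction 1 as [x Hx|x y z Hx Hxy Hr IH]; intros Wx Wy; [tauto|].
  destruct (classic (W y)) as [W1|W1].
  - destruct (IH W1 Wy) as [u [v [H1 H2]]]. exists u, v. split; auto.
    econstructor; eauto.
  - exists x, y. split; [constructor; auto|]. split; auto. split; auto.
    eapply reach_source; eauto.
Qed.

Lemma chain_shorten x l :
  chain adj x l -> exists l', chain adj x l' /\ last l' x = last l x /\ NoDup (x :: l') /\ incl l' l.
Proof.
  revert x. induction l as [|a l IH]; intros x H.
  - exists []. repeat split; auto. repeat constructor; auto. intros ? [].
  - destruct H as [Hxa H]. destruct (IH a H) as [l' [H1 [H2 [H3 H4]]]].
    rewrite last_cons_default.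
    destruct (classic (In x (a :: l'))) as [Hin|Hin].
    + apply in_split in Hin. destruct Hin as [p [q E]].
      assert (G : forall p b, chain adj b (p ++ x :: q) -> chain adj x q).
      { clear. induction p as [|c p IH]; simpl; intros b Hb; [tauto|]. destruct Hb. eauto. }
      assert (G2 : last (p ++ x :: q) x = last q x).
      { clear. induction p as [|c p IH]; simpl app; [apply last_cons_default|].
        rewrite last_cons_default. destruct p as [|d p].
        - simpl app. apply last_cons_default.
        - simpl app in *. rewrite last_cons_default in *. auto. }
      exists q. split.
      * apply (G p x). rewrite <- E. split; auto.
      * split; [|split].
        -- rewrite <- G2, <- E, last_cons_default. auto.
        -- rewrite E in H3. apply NoDup_app_remove_l in H3. auto.
        -- intros z Hz. assert (In z (a :: l')) as [->|Hz'] by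
             (rewrite E; apply in_or_app; right; right; auto); [left; auto|right; auto].
    + exists (a :: l'). split; [split; auto|]. split; [rewrite last_cons_default; auto|].
      split; [constructor; auto|].
      intros z [->|Hz]; [left; auto|right; auto].
Qed.

End Reach.

(** * Oriented separations *)

Definition sep (V : Type) : Type := ((V -> Prop) * (V -> Prop))%type.

Section Separations.
Context {V : Type}.
Implicit Types s r t : sep V.

Definition inv s : sep V := (snd s, fst s).
Definition le s r : Prop := subset (fst s) (fst r) /\ subset (snd r) (snd s).
Definition join s r : sep V :=
  (fun x => fst s x \/ fst r x, fun x => snd s x /\ snd r x).
Definition mid s : V -> Prop := sep_inter (fst s) (snd s).
Definition nested s r : Prop :=
  le s r \/ le s (inv r) \/ le (inv s) r \/ le (inv s) (inv r).

Lemma inv_inv s : inv (inv s) = s.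
Proof. destruct s; reflexivity. Qed.

Lemma le_refl s : le s s.
Proof. split; intros x; auto. Qed.

Lemma le_trans s r t : le s r -> le r t -> le s t.
Proof. intros [H1 H2] [H3 H4]. split; intros x Hx; auto. Qed.

Lemma le_antisym s r : le s r -> le r s -> s = r.
Proof.
  intros [H1 H2] [H3 H4]. destruct s, r. simpl in *.
  f_equal; apply set_ext; split; auto.
Qed.

Lemma le_inv s r : le s r -> le (inv r) (inv s).
Proof. intros [H1 H2]. split; auto. Qed.

Lemma le_inv_l s r : le (inv s) r -> le (inv r) s.
Proof. intros H. apply le_inv in H. rewrite inv_inv in H. auto. Qed.

Lemma le_inv_r s r : le s (inv r) -> le r (inv s).
Proof. intros H. apply le_inv in H. rewrite inv_inv in H. auto. Qed.

Lemma inv_le s r : le (inv s) (inv r) -> le r s.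
Proof. intros H. apply le_inv in H. rewrite !inv_inv in H. auto. Qed.

Lemma nested_sym s r : nested s r -> nested r s.
Proof.
  unfold nested. intros [H|[H|[H|H]]].
  - right; right; right. apply le_inv; auto.
  - right; left. apply le_inv_r; auto.
  - right; right; left. apply le_inv_l; auto.
  - left. apply inv_le; auto.
Qed.

Lemma nested_inv_l s r : nested (inv s) r <-> nested s r.
Proof. unfold nested. rewrite inv_inv. tauto. Qed.

Lemma nested_inv_r s r : nested s (inv r) <-> nested s r.
Proof. unfold nested. rewrite inv_inv. tauto. Qed.

Lemma join_l s r : le s (join s r).
Proof. split; intros x; simpl; tauto. Qed.

Lemma join_r s r : le r (join s r).
Proof. split; intros x; simpl; tauto. Qed.

Lemma join_lub s r t : le s t -> le r t -> le (join s r) t.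
Proof. intros [H1 H2] [H3 H4]. split; intros x; simpl; firstorder. Qed.

Lemma nested_join_l s r : nested s (join s r).
Proof. left. apply join_l. Qed.

Lemma nested_join_r s r : nested r (join s r).
Proof. left. apply join_r. Qed.

(** Of the sixteen positions of [t], the two that fix no side of [join s r] for [t] would make [s]
    and [r] nested. *)
Lemma nested_join s r t : ~ nested s r -> nested t s -> nested t r -> nested t (join s r).
Proof.
  intros Hx Hs Hr.
  assert (J1 := join_l s r). assert (J2 := join_r s r).
  destruct Hs as [H|[H|[H|H]]].
  - left. eapply le_trans; eauto.
  - destruct Hr as [H'|[H'|[H'|H']]].
    + left. eapply le_trans; eauto.
    + right; left. apply le_inv_r. apply join_lub; apply le_inv_r; auto.
    + right; right; left. eapply le_trans; eauto.
    + exfalso. apply Hx. right; left. eapply le_trans; [apply le_inv_r, H|].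
      apply H'.
  - right; right; left. eapply le_trans; eauto.
  - destruct Hr as [H'|[H'|[H'|H']]].
    + left. eapply le_trans; eauto.
    + exfalso. apply Hx. right; left. eapply le_trans; [apply inv_le, H|]. auto.
    + right; right; left. eapply le_trans; eauto.
    + right; right; right. apply le_inv. apply join_lub; apply inv_le; auto.
Qed.

(** The position of [t] relative to [s] passes by transitivity to the corner above [s] or to the one
    above [inv s]. *)
Lemma nested_opposite_joins s r t :
  nested t s -> nested t (join s r) \/ nested t (join (inv s) (inv r)).
Proof.
  assert (J1 := join_l s r). assert (J2 := join_l (inv s) (inv r)).
  intros [H|[H|[H|H]]].
  - left; left. eapply le_trans; eauto.
  - right; left. eapply le_trans; eauto.
  - left; right; right; left. eapply le_trans; eauto.
  - right; right; right; left. eapply le_trans; eauto.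
Qed.

Lemma join_comm s r : join s r = join r s.
Proof. unfold join. f_equal; apply set_ext; intros x; tauto. Qed.

Lemma nested_opposite_joins_r s r t :
  nested t r -> nested t (join s r) \/ nested t (join (inv s) (inv r)).
Proof.
  rewrite (join_comm s r), (join_comm (inv s) (inv r)). apply nested_opposite_joins.
Qed.

Lemma mid_inv s : mid (inv s) = mid s.
Proof. apply set_ext. intros x. unfold mid, sep_inter. simpl. tauto. Qed.

(** The second corner is the inverse of the infimum of [s] and [r], written with [join] so that one
    lattice operation serves for all four corners. *)
Lemma submodular s r a b :
  has_size (mid s) a -> has_size (mid r) b ->
  exists c d, has_size (mid (join s r)) c /\ has_size (mid (join (inv s) (inv r))) d /\
              c + d <= a + b.
Proof.
  intros Ha Hb.
  assert (F : finite_set (fun x => mid s x \/ mid r x))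
    by (apply finite_union; eapply has_size_finite; eauto).
  destruct (finite_has_size (mid (join s r))) as [c Hc].
  { eapply finite_subset; [exact F|]. intros x. unfold mid, sep_inter. simpl. tauto. }
  destruct (finite_has_size (mid (join (inv s) (inv r)))) as [d Hd].
  { eapply finite_subset; [exact F|]. intros x. unfold mid, sep_inter. simpl. tauto. }
  exists c, d. split; auto. split; auto.
  eapply has_size_four; eauto; intros x; unfold mid, sep_inter; simpl; tauto.
Qed.

End Separations.

(** * Tangles *)

Section Tangles.
Context {V : Type} (adj : V -> V -> Prop).
Context (adj_sym : forall u v, adj u v -> adj v u).
Implicit Types s r t : sep V.
Implicit Types P Q : (V -> Prop) -> (V -> Prop) -> Prop.

Definition isep s : Prop := is_separation adj (fst s) (snd s).
Definition holds P s : Prop := P (fst s) (snd s).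
Definition order s n : Prop := has_size (mid s) n.
Definition orients P n : Prop :=
  forall r m, isep r -> order r m -> m <= n -> holds P r \/ holds P (inv r).

Lemma order_inv s n : order (inv s) n <-> order s n.
Proof. unfold order. rewrite mid_inv. tauto. Qed.

Lemma isep_inv s : isep s -> isep (inv s).
Proof.
  intros [H1 H2]. split; simpl.
  - intros v. destruct (H1 v); auto.
  - intros u v Huv H3 H4 H5 H6. apply (H2 v u); auto.
Qed.

Lemma isep_edge s u v : isep s -> adj u v ->
  (fst s u /\ fst s v) \/ (snd s u /\ snd s v).
Proof.
  intros [H1 H2] Huv. specialize (H2 u v Huv) as H3. specialize (H2 v u (adj_sym _ _ Huv)) as H4.
  destruct (H1 u), (H1 v); tauto.
Qed.

Lemma isep_of_edges s :
  (forall x, fst s x \/ snd s x) ->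
  (forall u v, adj u v -> (fst s u /\ fst s v) \/ (snd s u /\ snd s v)) -> isep s.
Proof. intros H1 H2. split; auto. intros u v Huv. specialize (H2 u v Huv). tauto. Qed.

Lemma isep_join s r : isep s -> isep r -> isep (join s r).
Proof.
  intros Hs Hr. apply isep_of_edges; simpl.
  - intros x. destruct (proj1 Hs x), (proj1 Hr x); auto.
  - intros u v Huv. destruct (isep_edge s u v Hs Huv), (isep_edge r u v Hr Huv); tauto.
Qed.

Lemma tangle_isep P s : tangle adj P -> holds P s -> isep s /\ exists n, order s n.
Proof.
  intros [[k [H1 _]] _] Hs. destruct (H1 _ _ Hs) as [H2 H3]. split; auto.
  destruct k as [k|]; simpl in H3.
  - destruct H3 as [m [H3 _]]. exists m. auto.
  - apply finite_has_size. auto.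
Qed.

Lemma tangle_orients P s n : tangle adj P -> holds P s -> order s n -> orients P n.
Proof.
  intros [[k [H1 [H2 _]]] _] Hs Hn r m Hr Hm Hle. destruct (H1 _ _ Hs) as [_ H3].
  destruct k as [k|]; simpl in H3.
  - destruct H3 as [n' [H3 H4]]. assert (n' = n) by (eapply has_size_unique; eauto). subst.
    apply H2; auto. exists m. split; auto. lia.
  - apply H2; auto. eapply has_size_finite; eauto.
Qed.

Lemma tangle_not_full P s : tangle adj P -> holds P s -> (forall x, fst s x) -> False.
Proof.
  intros [_ H] Hs Hf. apply (H _ _ _ _ _ _ Hs Hs Hs). split; auto.
Qed.

Lemma tangle_not_both P s : tangle adj P -> holds P s -> holds P (inv s) -> False.
Proof.
  intros HP H1 H2. apply (tangle_not_full P s HP H1).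
  destruct HP as [[k [H3 [_ [H4 _]]]] _]. specialize (H4 _ _ H1 H2).
  intros x. destruct (proj1 (proj1 (H3 _ _ H1)) x); auto. apply H4; auto.
Qed.

(** Consistency speaks only about different separations, so the two ways in which [inv s] and [r]
    can orient the same one are treated apart. *)
Lemma tangle_down P s r :
  tangle adj P -> holds P r -> le s r -> holds P s \/ holds P (inv s) -> holds P s.
Proof.
  intros HP Hr [L1 L2] [H|H]; auto. exfalso.
  destruct HP as [[k [H3 [H3' [H4 H5]]]] H6] eqn:E.
  destruct (classic (sep_eq (fst (inv s)) (snd (inv s)) (fst r) (snd r))) as [[[Ea Eb]|[Ea Eb]]|N].
  - simpl in *. apply (tangle_not_full P r HP Hr).
    intros x. destruct (proj1 (proj1 (H3 _ _ Hr)) x) as [Hx|Hx]; auto.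
    apply L1. apply Eb. auto.
  - simpl in *. apply (tangle_not_both P r HP Hr).
    replace (inv r) with (inv s); auto. unfold inv. f_equal; apply set_ext; auto.
  - apply (H5 _ _ _ _ H Hr N). split; auto.
Qed.

(** The small sides of [s], [r] and the inverse of their join cover the graph: an edge inside
    neither [fst s] nor [fst r] lies in both big sides. *)
Lemma tangle_join P s r :
  tangle adj P -> holds P s -> holds P r ->
  holds P (join s r) \/ holds P (inv (join s r)) -> holds P (join s r).
Proof.
  intros HP Hs Hr [H|H]; auto. exfalso.
  assert (Is := proj1 (tangle_isep _ _ HP Hs)). assert (Ir := proj1 (tangle_isep _ _ HP Hr)).
  destruct HP as [_ HP]. apply (HP _ _ _ _ _ _ Hs Hr H). simpl. split.
  - intros x. destruct (proj1 Is x), (proj1 Ir x); auto.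
  - intros u v Huv. destruct (isep_edge s u v Is Huv), (isep_edge r u v Ir Huv); tauto.
Qed.

Definition dist P Q s : Prop :=
  (holds P s /\ holds Q (inv s)) \/ (holds P (inv s) /\ holds Q s).

Definition eff P Q k s : Prop :=
  tangle adj P /\ tangle adj Q /\ order s k /\ dist P Q s /\
  forall r m, dist P Q r -> order r m -> k <= m.

Definition esep k s : Prop := exists P Q, eff P Q k s.

Lemma eff_efficient P Q k s :
  eff P Q k s -> efficiently_distinguishes P Q (fst s) (snd s).
Proof.
  intros [_ [_ [H1 [H2 H3]]]]. split; auto. exists k. split; auto.
  intros C D m H4 H5. apply (H3 (C, D) m); auto.
Qed.

Lemma dist_inv P Q s : dist P Q (inv s) <-> dist P Q s.
Proof. unfold dist. rewrite inv_inv. tauto. Qed.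

Lemma dist_isep P Q s : tangle adj P -> dist P Q s -> isep s.
Proof.
  intros HP [[H _]|[H _]]; [eapply tangle_isep; eauto|].
  rewrite <- (inv_inv s). apply isep_inv. eapply tangle_isep; eauto.
Qed.

Lemma eff_isep P Q k s : eff P Q k s -> isep s.
Proof. intros [H [_ [_ [H' _]]]]. eapply dist_isep; eauto. Qed.

Lemma eff_inv P Q k s : eff P Q k s -> eff P Q k (inv s).
Proof.
  intros [H1 [H2 [H3 [H4 H5]]]]. repeat split; try apply H1; try apply H2; auto.
  - apply order_inv; auto.
  - apply dist_inv; auto.
Qed.

Lemma eff_sym P Q k s : eff P Q k s -> eff Q P k s.
Proof.
  intros [H1 [H2 [H3 [H4 H5]]]].
  split; [auto|]. split; [auto|]. split; [auto|].
  split; [unfold dist in *; tauto|].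
  intros r m Hr. apply H5. unfold dist in *; tauto.
Qed.

Lemma esep_inv k s : esep k s -> esep k (inv s).
Proof. intros [P [Q H]]. exists P, Q. apply eff_inv. auto. Qed.

Lemma eff_orients P Q k s : eff P Q k s -> orients P k /\ orients Q k.
Proof.
  intros [H1 [H2 [H3 [[[Ha Hb]|[Ha Hb]] H5]]]].
  - split; eapply tangle_orients; eauto. apply order_inv; auto.
  - split; eapply tangle_orients; eauto. apply order_inv; auto.
Qed.

Lemma distinguishable_eff P Q :
  tangle adj P -> tangle adj Q -> distinguishable P Q -> exists k s, eff P Q k s.
Proof.
  intros HP HQ [A [B H]]. change (dist P Q (A, B)) in H.
  assert (G : exists n, exists s, dist P Q s /\ order s n).
  { destruct H as [[H H']|[H H']].
    - destruct (tangle_isep _ _ HP H) as [_ [n Hn]]. exists n, (A, B). split; auto. left; auto.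
    - destruct (tangle_isep _ _ HQ H') as [_ [n Hn]]. exists n, (A, B). split; auto. right; auto. }
  destruct G as [n Hn]. destruct (least_nat (fun n => exists s, dist P Q s /\ order s n) n Hn) as [k [[s [Hs Hk]] Hmin]].
  exists k, s. repeat split; try apply HP; try apply HQ; auto.
  intros r m Hr Hm. apply Hmin. eauto.
Qed.

Lemma esep_proper k s : esep k s -> (exists x, fst s x /\ ~ snd s x) /\ (exists x, snd s x /\ ~ fst s x).
Proof.
  assert (G : forall P r, tangle adj P -> holds P r -> exists x, ~ fst r x).
  { intros P r HP Hr. apply NNPP. intros N. apply (tangle_not_full P r HP Hr).
    intros x. apply NNPP. eauto. }
  intros [P [Q E]]. assert (I := eff_isep _ _ _ _ E).
  destruct E as [HP [HQ [_ [[[Ha Hb]|[Ha Hb]] _]]]].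
  - destruct (G P s HP Ha) as [x Hx], (G Q _ HQ Hb) as [y Hy]. simpl in *.
    destruct (proj1 I x), (proj1 I y); try tauto. split; eauto.
  - destruct (G P _ HP Ha) as [x Hx], (G Q _ HQ Hb) as [y Hy]. simpl in *.
    destruct (proj1 I x), (proj1 I y); try tauto. split; eauto.
Qed.

Lemma esep_no_small k s r : esep k s -> isep r -> le s r -> le s (inv r) -> False.
Proof.
  intros Hs Hr [_ H1] [_ H2]. destruct (esep_proper _ _ Hs) as [[x [Hx Hx']] _].
  simpl in *. destruct (proj1 Hr x); auto.
Qed.

(** ** Corners *)

Definition or_inv s t : Prop := t = s \/ t = inv s.

(* Guarantees that [join x y] distinguishes [P] and [Q] as soon as both orient it. *)
Definition potential P Q x y : Prop :=
  (holds P x /\ holds P y /\ (holds Q (inv x) \/ holds Q (inv y))) \/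
  (holds Q x /\ holds Q y /\ (holds P (inv x) \/ holds P (inv y))).

Lemma orients_inv P n r m : orients P n -> isep r -> order r m -> m <= n ->
  holds P (inv r) \/ holds P r.
Proof. intros H1 H2 H3 H4. destruct (H1 r m); auto. Qed.

Lemma potential_dist P Q n x y m :
  tangle adj P -> tangle adj Q -> orients P n -> orients Q n ->
  potential P Q x y -> order (join x y) m -> m <= n -> dist P Q (join x y).
Proof.
  assert (G : forall P Q, tangle adj P -> tangle adj Q -> orients P n -> orients Q n ->
    holds P x -> holds P y -> holds Q (inv x) \/ holds Q (inv y) ->
    order (join x y) m -> m <= n -> holds P (join x y) /\ holds Q (inv (join x y))).
  { clear P Q. intros P Q HP HQ OP OQ Hx Hy Hq Hm Hle.
    assert (I : isep (join x y)) by (apply isep_join; apply (tangle_isep P); auto).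
    split.
    - apply tangle_join; auto. eapply OP; eauto.
    - assert (Z : holds Q (inv (join x y)) \/ holds Q (inv (inv (join x y)))).
      { rewrite inv_inv. eapply orients_inv; eauto. }
      destruct Hq as [Hq|Hq]; eapply tangle_down; eauto; apply le_inv; [apply join_l|apply join_r]. }
  intros HP HQ OP OQ [[H1 [H2 H3]]|[H1 [H2 H3]]] Hm Hle.
  - left. apply G; auto.
  - right. destruct (G Q P) as [G1 G2]; auto.
Qed.

Lemma eff_potential P Q k s x y m :
  eff P Q k s -> potential P Q x y -> order (join x y) m -> m <= k ->
  m = k /\ eff P Q k (join x y).
Proof.
  intros E Hp Hm Hle. destruct (eff_orients _ _ _ _ E) as [OP OQ].
  destruct E as [HP [HQ [_ [_ Hmin]]]].
  assert (D := potential_dist P Q k x y m HP HQ OP OQ Hp Hm Hle).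
  assert (k <= m) by (eapply Hmin; eauto).
  assert (m = k) by lia. subst. unfold eff. auto 7.
Qed.

(** With [y] the orientation of [r] common to [P] and [Q], both [join s y] and [join (inv s) y] are
    potential. By submodularity, if both had order above [k], the corners opposite to them would
    have order below [l]. *)
Lemma corner_of_smaller P Q P' Q' k l s r :
  eff P Q k s -> eff P' Q' l r -> l < k ->
  exists x y, or_inv s x /\ or_inv r y /\ eff P Q k (join x y).
Proof.
  intros E E' Hlt. assert (E0 := E). assert (E0' := E').
  destruct (eff_orients _ _ _ _ E) as [OP OQ].
  destruct (eff_orients _ _ _ _ E') as [OP' OQ'].
  assert (Ir := eff_isep _ _ _ _ E'). assert (Is := eff_isep _ _ _ _ E).
  destruct E as [HP [HQ [Hs [Hd Hmin]]]]. destruct E' as [HP' [HQ' [Hr [Hd' Hmin']]]].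
  (* As [l < k], the separation [r] cannot distinguish [P] from [Q]. *)
  assert (Y : exists y, or_inv r y /\ holds P y /\ holds Q y).
  { assert (Hlk : l <= k) by lia.
    destruct (OP r l Ir Hr Hlk) as [H|H], (OQ r l Ir Hr Hlk) as [H'|H'].
    - exists r. unfold or_inv; auto.
    - exfalso. assert (k <= l) by (apply (Hmin r l); [left; auto|auto]). lia.
    - exfalso. assert (k <= l) by (apply (Hmin r l); [right; auto|auto]). lia.
    - exists (inv r). unfold or_inv; auto. }
  destruct Y as [y [Hy [Py Qy]]].
  assert (Hyl : order y l) by (destruct Hy as [->| ->]; auto; apply order_inv; auto).
  assert (Iy : isep y) by (apply (tangle_isep P); auto).
  destruct (submodular s y k l Hs Hyl) as [c1 [d1 [Hc1 [Hd1 Hsum1]]]].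
  assert (Hs' : order (inv s) k) by (apply order_inv; auto).
  destruct (submodular (inv s) y k l Hs' Hyl) as [c2 [d2 [Hc2 [Hd2 Hsum2]]]].
  rewrite inv_inv in Hd2.
  destruct (le_lt_dec c1 k) as [L1|L1].
  { exists s, y. unfold or_inv at 1. split; auto. split; auto.
    eapply eff_potential; eauto. unfold potential, dist in *. tauto. }
  destruct (le_lt_dec c2 k) as [L2|L2].
  { exists (inv s), y. unfold or_inv at 1. split; auto. split; auto.
    eapply eff_potential; eauto. unfold potential, dist in *.
    rewrite inv_inv. tauto. }
  exfalso.
  assert (Dy : dist P' Q' y) by (destruct Hy as [->| ->]; auto; apply dist_inv; auto).
  (* Otherwise both corners on the far side of [y] have order below [l], so [P'] and [Q']
     orient them alike; together with [y] or its inverse they cover the graph. *)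
  assert (F : forall P1 Q1, eff P1 Q1 l r -> holds P1 y -> holds Q1 (inv y) -> False).
  { clear P' Q' E0' OP' OQ' HP' HQ' Hd' Hmin' Dy.
    intros P1 Q1 E1 Py1 Qy1. destruct (eff_orients _ _ _ _ E1) as [OP1 OQ1].
    destruct E1 as [HP1 [HQ1 [_ [_ Hmin1]]]].
    (* The inverse of this corner lies below [y], hence in [P1]; having order below [l] it does not
       distinguish, hence it lies in [Q1] too. *)
    assert (C : forall z m, isep z -> order (join z (inv y)) m -> m < l ->
                 holds Q1 (inv (join z (inv y)))).
    { intros z m Iz Hm Hml.
      assert (I : isep (join z (inv y))) by (apply isep_join; auto; apply isep_inv; auto).
      assert (A1 : holds P1 (inv (join z (inv y)))).
      { eapply tangle_down; eauto.
        - rewrite <- (inv_inv y) at 2. apply le_inv. apply join_r.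
        - rewrite inv_inv. eapply orients_inv; eauto. lia. }
      destruct (OQ1 _ _ I Hm ltac:(lia)) as [A2|A2]; [|auto].
      exfalso. assert (l <= m); [|lia]. apply (Hmin1 (join z (inv y)) m); [right; auto|auto]. }
    assert (A1 := C (inv s) d1 (isep_inv _ Is) Hd1 ltac:(lia)).
    assert (A2 := C s d2 Is Hd2 ltac:(lia)).
    destruct HQ1 as [_ HQ1]. apply (HQ1 _ _ _ _ _ _ A1 A2 Qy1). simpl. split.
    - intros x. destruct (proj1 Is x), (proj1 Iy x); tauto.
    - intros u v Huv. destruct (isep_edge s u v Is Huv), (isep_edge y u v Iy Huv); tauto. }
  destruct Dy as [[D1 D2]|[D1 D2]].
  - eapply F; eauto.
  - eapply (F Q' P'); eauto. apply eff_sym; auto.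
Qed.

(** Each tangle occupies the corner given by its orientations of [s] and [r], and a corner occupied
    by a tangle of a pair is potential for that pair. The second alternative serves the case where
    the two pairs occupy different diagonals. *)
Lemma opposite_corners P Q P' Q' k s r :
  eff P Q k s -> eff P' Q' k r ->
  (exists x y, or_inv s x /\ or_inv r y /\
     eff P Q k (join x y) /\ eff P' Q' k (join (inv x) (inv y))) \/
  ((exists x y, or_inv s x /\ or_inv r y /\
     eff P Q k (join x y) /\ eff P Q k (join (inv x) (inv y))) /\
   (exists x y, or_inv s x /\ or_inv r y /\
     eff P' Q' k (join x y) /\ eff P' Q' k (join (inv x) (inv y)))).
Proof.
  intros E E'.
  assert (Ir := eff_isep _ _ _ _ E'). assert (Is := eff_isep _ _ _ _ E).
  (* The orders of two opposite corners sum to at most [k + k], and a potential corner has order at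
     least [k], so both orders equal [k]. *)
  assert (Z : forall P1 Q1 P2 Q2 x y, (exists t1, eff P1 Q1 k t1) -> (exists t2, eff P2 Q2 k t2) ->
    or_inv s x -> or_inv r y -> potential P1 Q1 x y -> potential P2 Q2 (inv x) (inv y) ->
    eff P1 Q1 k (join x y) /\ eff P2 Q2 k (join (inv x) (inv y))).
  { intros P1 Q1 P2 Q2 x y [t1 E1] [t2 E2] Hx Hy Pa Pb.
    assert (Ox : order x k).
    { destruct Hx as [->| ->]; [|apply order_inv]; apply E. }
    assert (Oy : order y k).
    { destruct Hy as [->| ->]; [|apply order_inv]; apply E'. }
    destruct (submodular x y k k Ox Oy) as [c [d [Hc [Hd Hsum]]]].
    destruct (le_lt_dec c k) as [Lc|Lc].
    - destruct (eff_potential _ _ _ _ _ _ _ E1 Pa Hc Lc) as [-> E3]. split; auto.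
      eapply eff_potential; eauto. lia.
    - exfalso. destruct (eff_potential _ _ _ _ _ _ _ E2 Pb Hd); lia. }
  assert (X : exists t1, eff P Q k t1) by eauto.
  assert (X' : exists t1, eff P' Q' k t1) by eauto.
  destruct (eff_orients _ _ _ _ E) as [OP OQ].
  destruct (eff_orients _ _ _ _ E') as [OP' OQ'].
  destruct E as [_ [_ [Hs [Hd _]]]]. destruct E' as [_ [_ [Hr [Hd' _]]]].
  assert (W : (exists x y, or_inv s x /\ or_inv r y /\
     potential P Q x y /\ potential P' Q' (inv x) (inv y)) \/
    ((exists x y, or_inv s x /\ or_inv r y /\
     potential P Q x y /\ potential P Q (inv x) (inv y)) /\
     (exists x y, or_inv s x /\ or_inv r y /\
     potential P' Q' x y /\ potential P' Q' (inv x) (inv y)))).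
  { clear Z X X'.
    specialize (OP r k Ir Hr (le_n k)). specialize (OQ r k Ir Hr (le_n k)).
    specialize (OP' s k Is Hs (le_n k)). specialize (OQ' s k Is Hs (le_n k)).
    clear Is Ir Hs Hr.
    (* The four ordered pairs of opposite corners, spelled out so that [tauto] can search them. *)
    assert (Y : forall p q : sep V -> sep V -> Prop,
      (p s r /\ q (inv s) (inv r)) \/ (p s (inv r) /\ q (inv s) r) \/
      (p (inv s) r /\ q s (inv r)) \/ (p (inv s) (inv r) /\ q s r) ->
      exists x y, or_inv s x /\ or_inv r y /\ p x y /\ q (inv x) (inv y)).
    { intros p q [H|[H|[H|H]]]; [exists s, r|exists s, (inv r)|exists (inv s), r|
        exists (inv s), (inv r)]; unfold or_inv; rewrite ?inv_inv; tauto. }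
    destruct Hd as [[D1 D2]|[D1 D2]]; destruct Hd' as [[D1' D2']|[D1' D2']];
    destruct OP as [O1|O1]; destruct OQ as [O2|O2];
    destruct OP' as [O1'|O1']; destruct OQ' as [O2'|O2'];
    first [ left; apply Y; unfold potential; rewrite !inv_inv; tauto
          | right; split; apply Y; unfold potential; rewrite !inv_inv; tauto ]. }
  destruct W as [[x [y [Hx [Hy [Pa Pb]]]]]|[[x [y [Hx [Hy [Pa Pb]]]]] [x' [y' [Hx' [Hy' [Pa' Pb']]]]]]].
  - left. exists x, y. auto 6.
  - right. split; [exists x, y|exists x', y']; split; auto.
Qed.

End Tangles.

(** * Components and tight separators *)

Section Components.
Context {V : Type} (adj : V -> V -> Prop).
Context (adj_sym : forall u v, adj u v -> adj v u).
Context (conn : forall u v, reach adj (fun _ => True) u v).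
Context (nbrs_finite : forall v, finite_set (adj v)).
Implicit Types s r t : sep V.
Implicit Types P Q : (V -> Prop) -> (V -> Prop) -> Prop.

Local Notation isep := (isep adj).
Local Notation orients := (orients adj).
Local Notation eff := (eff adj).
Local Notation esep := (esep adj).

Lemma isep_walk_meets s (Q : V -> Prop) a b :
  isep s -> reach adj Q a b -> fst s a -> snd s b -> exists z, Q z /\ mid s z.
Proof.
  intros Is H. induction H as [x Hx|x y z Hx Hxy Hr IH]; intros Ha Hb.
  - exists x. split; auto. split; auto.
  - destruct (isep_edge adj adj_sym s x y Is Hxy) as [[H1 H2]|[H1 H2]]; auto.
    exists x. split; auto. split; auto.
Qed.

Lemma isep_same_side s (Q : V -> Prop) a b :
  isep s -> reach adj Q a b -> (forall z, Q z -> ~ mid s z) -> fst s a -> fst s b /\ ~ snd s b.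
Proof.
  intros Is H HQ Ha.
  assert (N : ~ snd s b).
  { intros Hb. destruct (isep_walk_meets s Q a b Is H Ha Hb) as [z [Hz Hm]]. eapply HQ; eauto. }
  split; auto. destruct (proj1 Is b); tauto.
Qed.

(** * Components and the separations they cut off *)

Definition comp (S : V -> Prop) (x : V) : V -> Prop := reach adj (fun z => ~ S z) x.

Lemma finite_nbrs (S : V -> Prop) : finite_set S -> finite_set (fun u => exists v, S v /\ adj v u).
Proof. intros H. apply finite_bounded_union; auto. Qed.

Lemma comp_closed S x u v : comp S x u -> adj u v -> ~ S v -> comp S x v.
Proof.
  intros H1 H2 H3. apply reach_trans with u; [exact H1|]. apply reach_edge; auto.
  exact (reach_target _ _ _ _ H1).
Qed.

Lemma comp_out S x u : comp S x u -> ~ S u.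
Proof. intros H. apply (reach_target _ _ _ _ H). Qed.

Lemma exit_to S x y : ~ S x -> S y -> exists u v, comp S x u /\ adj u v /\ S v.
Proof.
  intros Hx Hy. destruct (reach_exit adj _ (fun z => ~ S z) x y (conn x y)) as [u [v [H1 [H2 [_ H3]]]]]; auto.
  exists u, v. split; [|split; auto].
  - eapply reach_mono; [|exact H1]. simpl; tauto.
  - apply NNPP; auto.
Qed.

Lemma finitely_many_components S y0 :
  finite_set S -> S y0 ->
  exists l, (forall x, In x l -> ~ S x) /\ forall z, ~ S z -> exists x, In x l /\ comp S x z.
Proof.
  intros HS H0. destruct (finite_nbrs S HS) as [l Hl].
  exists (cfilter (fun x => ~ S x) l). split.
  - intros x Hx. apply in_cfilter in Hx. tauto.
  - intros z Hz. destruct (exit_to S z y0 Hz H0) as [u [v [H1 [H2 H3]]]].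
    exists u. split.
    + apply in_cfilter. split; [apply Hl; eauto|]. eapply comp_out; eauto.
    + apply reach_sym; auto.
Qed.

(* A separation with separator [S] if [U] is a union of components of [G - S]. *)
Definition usep (S U : V -> Prop) : sep V := (fun z => ~ U z, fun z => U z \/ S z).

Definition closed_off (S U : V -> Prop) : Prop :=
  (forall z, U z -> ~ S z) /\ (forall u v, U u -> adj u v -> U v \/ S v).

Lemma usep_isep S U : closed_off S U -> isep (usep S U).
Proof.
  intros [H1 H2]. apply isep_of_edges; simpl.
  - intros x. tauto.
  - intros u v Huv. assert (H3 := H2 u v). assert (H4 := H2 v u).
    assert (adj v u) by auto. tauto.
Qed.

Lemma usep_mid S U : closed_off S U -> mid (usep S U) = S.
Proof.
  intros [H1 H2]. apply set_ext. intros x. specialize (H1 x). unfold mid, sep_inter. simpl. tauto.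
Qed.

Lemma comp_closed_off S x : closed_off S (comp S x).
Proof.
  split.
  - apply comp_out.
  - intros u v Hu Huv. destruct (classic (S v)); auto. left. eapply comp_closed; eauto.
Qed.

Lemma union_closed_off S (l : list V) : closed_off S (fun z => exists x, In x l /\ comp S x z).
Proof.
  split.
  - intros z [x [_ H]]. eapply comp_out; eauto.
  - intros u v [x [Hx Hu]] Huv. destruct (classic (S v)); auto. left. exists x. split; auto.
    eapply comp_closed; eauto.
Qed.

(* What tangles and directions have in common. *)
Record tangle_like P : Prop := {
  tl_join : forall s r, holds P s -> holds P r ->
    holds P (join s r) \/ holds P (inv (join s r)) -> holds P (join s r);
  tl_full : forall s, holds P s -> (forall x, fst s x) -> False }.

Lemma tangle_tangle_like P : tangle adj P -> tangle_like P.
Proof.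
  intros HP. split.
  - intros; apply (tangle_join adj adj_sym); auto.
  - intros; eapply tangle_not_full; eauto.
Qed.

(** There are finitely many components, since each contains a neighbour of the nonempty finite set
    [S]. If [P] pointed away from all of them, joining them one by one would put into [P] a
    separation whose small side is everything. *)
Lemma tangle_like_component P S n y0 :
  tangle_like P -> has_size S n -> orients P n -> S y0 ->
  exists x, ~ S x /\ holds P (usep S (comp S x)).
Proof.
  intros HP HS OP H0. apply NNPP. intros N.
  assert (O : forall U, closed_off S U -> holds P (usep S U) \/ holds P (inv (usep S U))).
  { intros U HU. apply (OP _ n); auto; [apply usep_isep; auto|].
    unfold order. rewrite usep_mid; auto. }
  assert (C : forall l, (forall x, In x l -> ~ S x) ->
     holds P (inv (usep S (fun z => exists x, In x l /\ comp S x z)))).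
  { induction l as [|a l IH]; intros Hl.
    - destruct (O _ (union_closed_off S [])) as [H|H]; auto. exfalso.
      apply (tl_full P HP _ H). intros x [y [[] _]].
    - assert (E : inv (usep S (fun z => exists x, In x (a :: l) /\ comp S x z)) =
        join (inv (usep S (comp S a))) (inv (usep S (fun z => exists x, In x l /\ comp S x z)))).
      { unfold inv, usep, join; simpl. f_equal; apply set_ext; intros z; split.
        - intros [[x [[->|Hx] H]]|H]; eauto.
        - intros [[H|H]|[[x [Hx H]]|H]]; eauto.
        - intros H. split; intros H'; apply H; eauto. destruct H' as [x [Hx H']]. eauto.
        - intros [H H'] [x [[->|Hx] Hz]]; eauto. }
      rewrite E. apply tl_join; auto.
      + destruct (O _ (comp_closed_off S a)) as [H|H]; auto. exfalso. apply N. exists a.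
        split; auto. apply Hl. simpl; auto.
      + apply IH. intros; apply Hl; simpl; auto.
      + rewrite <- E. destruct (O _ (union_closed_off S (a :: l))); rewrite ?inv_inv; auto. }
  destruct (finitely_many_components S y0 (has_size_finite _ _ HS) H0) as [l [Hl Hz]].
  apply (tl_full P HP _ (C l Hl)). simpl. intros x. destruct (classic (S x)); auto.
Qed.

(** * Full components of efficient distinguishers *)

Definition full_component s x : Prop :=
  ~ mid s x /\ (forall z, comp (mid s) x z -> fst s z /\ ~ snd s z) /\
  (forall y, mid s y -> exists u, comp (mid s) x u /\ adj u y).

Lemma esep_mid_nonempty k s : esep k s -> exists y, mid s y.
Proof.
  intros H. destruct (esep_proper adj adj_sym _ _ H) as [[a [Ha _]] [b [Hb _]]].
  destruct H as [P [Q H]].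
  destruct (isep_walk_meets s _ a b (eff_isep _ adj_sym _ _ _ _ H) (conn a b)) as [z [_ Hz]]; eauto.
Qed.

(** The component [K] to which [P] points lies in [fst s]. It is full because otherwise a smaller
    separator around [K] would still distinguish [P] from [Q]. *)
Lemma eff_full_component P Q k s :
  eff P Q k s -> holds P (inv s) -> holds Q s -> exists x, full_component s x.
Proof.
  intros E HPs HQs. destruct (eff_orients _ _ _ _ _ E) as [OP OQ].
  destruct (esep_mid_nonempty k s) as [y0 Hy0]; [exists P, Q; auto|].
  assert (Is := eff_isep _ adj_sym _ _ _ _ E).
  destruct E as [HP [HQ [Hs [_ Hmin]]]].
  assert (TP := tangle_tangle_like P HP).
  destruct (tangle_like_component P (mid s) k y0 TP Hs OP Hy0) as [x [Hx HK]].
  set (K := comp (mid s) x) in *.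
  (* Joined with [usep (mid s) K], such an [r] would yield a member of [P] whose small side is
     everything. *)
  assert (Cj : forall r, holds P r -> (forall z, K z -> fst r z) -> (forall z, mid s z -> snd r z) ->
                (forall z, K z -> snd r z -> False) -> False).
  { intros r Hr H1 H2 H3.
    assert (J : join (usep (mid s) K) r = (fun _ => True, mid s)).
    { unfold join, usep; simpl. f_equal; apply set_ext; intros z.
      - specialize (H1 z). destruct (classic (K z)); tauto.
      - specialize (H2 z). specialize (H3 z). tauto. }
    assert (holds P (fun _ => True, mid s)) as Hf.
    { rewrite <- J. apply tl_join; auto. rewrite J. apply (OP _ k); auto.
      - apply isep_of_edges; simpl; auto.
      - unfold order. replace (mid (fun _ => True, mid s)) with (mid s); auto.
        apply set_ext. intros z. unfold mid at 2, sep_inter. simpl. tauto. }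
    apply (tl_full P TP _ Hf). simpl; auto. }
  assert (Hside : fst s x).
  { destruct (proj1 Is x) as [H|H]; auto. exfalso.
    assert (HS : forall z, K z -> snd s z /\ ~ fst s z).
    { intros z Hz. apply (isep_same_side (inv s) _ x z (isep_inv adj adj_sym s Is) Hz); auto.
      intros w Hw. rewrite mid_inv. auto. }
    apply (Cj (inv s) HPs); simpl.
    - intros z Hz. apply HS; auto.
    - intros z Hz. apply Hz.
    - intros z Hz. apply HS; auto. }
  assert (HS : forall z, K z -> fst s z /\ ~ snd s z).
  { intros z Hz. apply (isep_same_side s _ x z Is Hz); auto. }
  exists x. split; auto. split; auto.
  (* A vertex of the separator without neighbour in [K] could be moved off the separator. *)
  intros y Hy. apply NNPP. intros N.
  set (s' := usep (fun z => mid s z /\ z <> y) K).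
  assert (C' : closed_off (fun z => mid s z /\ z <> y) K).
  { split.
    - intros z Hz [Hm _]. eapply comp_out; eauto.
    - intros u v Hu Huv. destruct (proj2 (comp_closed_off (mid s) x) u v Hu Huv); auto.
      right. split; auto. intros ->. apply N. exists u. auto. }
  assert (Is' : isep s') by (apply usep_isep; auto).
  destruct (finite_has_size (mid s')) as [m Hm].
  { unfold s'. rewrite usep_mid; auto. eapply finite_subset; [eapply has_size_finite, Hs|].
    simpl; tauto. }
  assert (Hlt : m < k).
  { assert (m + 0 < k + 0); [|lia].
    apply (has_size_four_lt (mid s') (fun _ => False) (mid s) (fun _ => False) m 0 k 0) with y;
      auto using has_size_empty; unfold s'; rewrite ?usep_mid by auto; tauto. }
  assert (Ps' : holds P s').
  { destruct (OP s' m Is' Hm ltac:(lia)) as [H|H]; auto. exfalso.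
    apply (Cj (inv s') H); simpl; auto.
    intros z Hz HKz. eapply comp_out; eauto. }
  assert (Qs' : holds Q (inv s')).
  { apply (tangle_down adj Q (inv s') s); auto.
    - split; simpl.
      + intros z [Hz|[Hz _]]; [apply HS; auto|apply Hz].
      + intros z Hz HKz. apply (proj2 (HS z HKz)). auto.
    - rewrite inv_inv. destruct (OQ s' m Is' Hm ltac:(lia)); auto. }
  assert (k <= m); [|lia]. apply (Hmin s' m); auto. left. auto.
Qed.

Lemma esep_full_component k s : esep k s -> exists x, full_component s x.
Proof.
  intros [P [Q E]]. assert (E0 := E). destruct E as [_ [_ [_ [[[H1 H2]|[H1 H2]] _]]]].
  - apply (eff_full_component Q P k s); auto. apply eff_sym; auto.
  - apply (eff_full_component P Q k s); auto.
Qed.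

(** * Finiteness of tight separators *)

Definition minsep (D : V -> Prop) (u1 u2 : V) (Y : V -> Prop) : Prop :=
  (forall y, Y y -> ~ D y) /\ ~ reach adj (fun z => ~ D z /\ ~ Y z) u1 u2 /\
  (forall y, Y y -> reach adj (fun z => ~ D z /\ (Y z -> z = y)) u1 u2).

(* Every [Y] in question meets a fixed walk; delete the vertex where it does and use induction. *)
Lemma finitely_many_minseps k D u1 u2 :
  finite_set (fun Y => has_size Y k /\ minsep D u1 u2 Y).
Proof.
  revert D. induction k as [|k IH]; intros D.
  - exists [fun _ => False]. intros Y [HY _]. left. apply set_ext.
    intros x. generalize (has_size_0 _ HY x). tauto.
  - destruct (classic (reach adj (fun z => ~ D z) u1 u2)) as [R|R].
    + destruct (reach_finite _ _ _ _ R) as [Z [HZ [HZD HR]]].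
      apply finite_subset with (fun Y => exists z, Z z /\
          (Y z /\ has_size Y (S k) /\ minsep D u1 u2 Y)).
      * apply finite_bounded_union; auto. intros z Hz.
        (* Moving [z] from [Y] to the deleted set preserves all clauses of [minsep] and lowers the
           size by one; knowing [z], the set [Y] can be recovered. *)
        apply finite_inj with (S' := fun Y => has_size Y k /\ minsep (fun w => D w \/ w = z) u1 u2 Y)
          (f := fun Y w => Y w /\ w <> z); auto.
        -- intros Y [Yz [HY [H1 [H2 H3]]]]. split.
           { destruct (finite_has_size (fun w => Y w /\ w <> z)) as [n Hn].
             - eapply finite_subset; [eapply has_size_finite, HY|]. simpl; tauto.
             - assert (S1 : has_size (fun w => w = z) 1).
               { exists [z]. split; [repeat constructor; auto|]. split; auto.
                 simpl. intros x; split; auto. intros [->|[]]; auto. }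
               assert (n + 1 <= S k + 0).
               { apply (has_size_four (fun w => Y w /\ w <> z) (fun w => w = z) Y (fun _ => False));
                   auto using has_size_empty; intros x; try tauto. intros ->; auto. }
               assert (S k + 0 <= n + 1).
               { apply (has_size_four Y (fun _ => False) (fun w => Y w /\ w <> z) (fun w => w = z));
                   auto using has_size_empty; intros x; try tauto. }
               replace k with n by lia. auto. }
           split; [|split].
           ++ intros y [Hy E] [Hd|Hd]; auto. apply (H1 y); auto.
           ++ intros HR'. apply H2. eapply reach_mono; [|exact HR']. simpl. intros w; tauto.
           ++ intros y [Hy E]. eapply reach_mono; [|exact (H3 y Hy)]. simpl.
              intros w [Hw1 Hw2]. split; [intros [Hd|Hd]; auto; subst w; apply E; symmetry; auto|tauto].
        -- intros Y Y' [Hz1 _] [Hz2 _] E. apply set_ext. intros w.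
           assert (E' := f_equal (fun F => F w) E). simpl in E'.
           destruct (classic (w = z)) as [->|N]; [tauto|].
           assert (Y w /\ w <> z <-> Y' w /\ w <> z) by (rewrite E'; tauto). tauto.
      * intros Y [HY M]. destruct M as [H1 [H2 H3]].
        destruct (classic (exists z, Z z /\ Y z)) as [[z [Hz Yz]]|N].
        -- exists z. repeat split; auto.
        -- exfalso. apply H2. eapply reach_mono; [|exact HR]. simpl. intros w Hw.
           split; auto. intros Yw. apply N. eauto.
    + exists []. intros Y [HY [_ [_ H3]]]. exfalso.
      destruct (has_size_pos Y (S k) HY) as [y Hy]; [lia|]. apply R.
      eapply reach_mono; [|exact (H3 y Hy)]. simpl; tauto.
Qed.

(** Each component outside [Y] lies on one side and contains a neighbour of [Y]. So the separation
    is determined by which of these finitely many neighbours belong to [fst]. *)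
Lemma finitely_many_with_mid (Y : V -> Prop) y0 :
  finite_set Y -> Y y0 -> finite_set (fun s => isep s /\ mid s = Y).
Proof.
  intros HY H0.
  apply finite_inj with (S' := fun X : V -> Prop => forall x, X x -> exists v, Y v /\ adj v x)
    (f := fun s x => fst s x /\ exists v, Y v /\ adj v x).
  - apply finite_powerset. apply finite_nbrs. auto.
  - intros s _ x [_ H]. auto.
  - assert (G : forall s r, isep s -> mid s = Y -> isep r -> mid r = Y ->
      (forall x, (fst s x /\ exists v, Y v /\ adj v x) -> fst r x) -> forall x, fst s x -> fst r x).
    { intros s r Is Es Ir Er H x Hx. destruct (classic (Y x)) as [Yx|Nx].
      - rewrite <- Er in Yx. apply Yx.
      - destruct (exit_to Y x y0 Nx H0) as [u [v [H1 [H2 H3]]]].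
        assert (fst s u) by (apply (isep_same_side s _ x u Is H1); [rewrite Es|]; auto).
        apply (isep_same_side r _ u x Ir (reach_sym _ _ _ _ adj_sym H1)); [rewrite Er; auto|].
        apply H. eauto. }
    intros s r [Is Es] [Ir Er] E.
    assert (E' : forall x, (fst s x /\ exists v, Y v /\ adj v x) <-> (fst r x /\ exists v, Y v /\ adj v x)).
    { intros x. assert (E' := f_equal (fun F => F x) E). simpl in E'. rewrite E'. tauto. }
    assert (F : forall x, fst s x <-> fst r x).
    { intros x; split; [apply (G s r)|apply (G r s)]; auto; intros w Hw; apply E' in Hw; tauto. }
    apply le_antisym; split; intros x; simpl; try apply F.
    + intros Hx. assert (M : mid s x <-> mid r x) by (rewrite Es, Er; tauto).
      destruct (proj1 Is x) as [Hf|]; auto. apply M. split; auto. apply F; auto.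
    + intros Hx. assert (M : mid s x <-> mid r x) by (rewrite Es, Er; tauto).
      destruct (proj1 Ir x) as [Hf|]; auto. apply M. split; auto. apply F; auto.
Qed.

Lemma full_components_minsep s x1 x2 y u1 u2 :
  isep s -> full_component s x1 -> full_component (inv s) x2 ->
  comp (mid s) x1 u1 -> comp (mid s) x2 u2 -> mid s y -> minsep (fun _ => False) u1 u2 (mid s).
Proof.
  intros Is [N1 [A1 B1]] [N2 [A2 B2]] C1 C2 Hy. rewrite mid_inv in *. simpl in *.
  split; [auto|]. split.
  - intros R. destruct (isep_walk_meets s _ u1 u2 Is R) as [z [Hz Hm]]; [apply A1; auto|apply A2; auto|tauto].
  - intros y' Hy'. destruct (B1 y' Hy') as [v1 [D1 E1]], (B2 y' Hy') as [v2 [D2 E2]].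
    assert (M : forall a b, comp (mid s) a b -> reach adj (fun z => ~ False /\ (mid s z -> z = y')) a b).
    { intros a b H. eapply reach_mono; [|exact H]. simpl; tauto. }
    apply reach_trans with x1; [apply M, reach_sym; auto|].
    apply reach_trans with v1; [apply M; auto|].
    apply reach_step with y'; [split; auto; intros H; destruct (comp_out _ _ _ D1 H)|auto|].
    apply reach_step with v2; [split; auto|auto|].
    apply reach_trans with x2; [apply M, reach_sym; auto|apply M; auto].
Qed.

(** Both sides have full components, so a vertex of [Z] in the separator has a neighbour in each.
    The separator is then a minimal separator of two of the finitely many neighbours of [Z]. *)
Lemma finitely_many_eseps_meeting k Z :
  finite_set Z -> finite_set (fun s => esep k s /\ exists z, Z z /\ mid s z).
Proof.
  intros HZ. assert (HN := finite_nbrs Z HZ).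
  assert (F : finite_set (fun Y => exists u1, (exists v, Z v /\ adj v u1) /\
      exists u2, (exists v, Z v /\ adj v u2) /\
      (has_size Y k /\ minsep (fun _ => False) u1 u2 Y))).
  { apply finite_bounded_union; auto. intros u1 _. apply finite_bounded_union; auto. intros u2 _.
    apply finitely_many_minseps. }
  apply finite_subset with (fun s => exists Y, ((exists u1, (exists v, Z v /\ adj v u1) /\
      exists u2, (exists v, Z v /\ adj v u2) /\
      (has_size Y k /\ minsep (fun _ => False) u1 u2 Y)) /\ exists y, Y y) /\ (isep s /\ mid s = Y)).
  - apply finite_bounded_union.
    + eapply finite_subset; [exact F|]. simpl. intros Y [H _]. exact H.
    + intros Y [[u1 [_ [u2 [_ [H _]]]]] [y Hy]]. apply finitely_many_with_mid with y; auto.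
      eapply has_size_finite; eauto.
  - intros s [Hs [z [Hz Hm]]]. exists (mid s).
    assert (Is : isep s) by (destruct Hs as [P [Q E]]; eapply eff_isep; eauto).
    split; auto. split; [|eauto].
    destruct (esep_full_component k s Hs) as [x1 F1].
    destruct (esep_full_component k (inv s) (esep_inv adj k s Hs)) as [x2 F2].
    destruct (proj2 (proj2 F1) z Hm) as [u1 [C1 D1]].
    destruct (proj2 (proj2 F2) z) as [u2 [C2 D2]]; [rewrite mid_inv; auto|].
    rewrite mid_inv in C2.
    exists u1. split; [eauto|]. exists u2. split; [eauto|]. split.
    + destruct Hs as [P [Q [_ [_ [H _]]]]]. exact H.
    + apply full_components_minsep with x1 x2 z; auto.
Qed.

(** Every vertex of the side reaches the separator inside that side, and all of the separator is
    attached to the full component. *)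
Lemma full_component_connects s x y a :
  isep s -> full_component s x -> mid s y -> fst s a -> reach adj (fst s) a x.
Proof.
  intros Is [N [A B]] Hy Ha.
  assert (G : forall y, mid s y -> reach adj (fst s) y x).
  { clear y Hy. intros y Hy. destruct (B y Hy) as [u [Hu Huy]].
    apply reach_step with u; [apply Hy|auto|]. apply reach_sym; auto.
    eapply reach_mono; [|apply reach_within, Hu]. intros z Hz. apply A; auto. }
  destruct (classic (mid s a)) as [Hm|Hm]; auto.
  destruct (exit_to (mid s) a y Hm Hy) as [u [v [H1 [H2 H3]]]].
  apply reach_trans with v; auto. apply reach_trans with u.
  - eapply reach_mono; [|apply reach_within, H1]. intros z Hz.
    apply (isep_same_side s _ a z Is Hz); auto.
  - apply reach_edge; auto; [|apply H3]. apply (isep_same_side s _ a u Is H1); auto.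
Qed.

Lemma esep_isep k s : esep k s -> isep s.
Proof. intros [P [Q E]]. eapply eff_isep; eauto. Qed.

(** Walks from [x0] enclose [mid s] in a finite connected set [Z]. If the separator of [r] misses
    [Z], then [Z] lies strictly on one side of [r]; the other side of [r] is connected and avoids
    [mid s], so it lies on one side of [s]. *)
Lemma finitely_many_crossing k l s :
  esep k s -> finite_set (fun r => esep l r /\ ~ nested s r).
Proof.
  intros Hs. assert (Is := esep_isep k s Hs).
  destruct (esep_mid_nonempty k s Hs) as [x0 Hx0].
  destruct (choice (fun x Z => finite_set Z /\ reach adj Z x0 x)) as [W HW].
  { intros x. destruct (reach_finite _ _ _ _ (conn x0 x)) as [Z [H1 [_ H2]]]. eauto. }
  set (Z := fun w => exists x, mid s x /\ W x w).
  assert (HZ : finite_set Z).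
  { apply finite_bounded_union; [|intros; apply HW].
    destruct Hs as [P [Q [_ [_ [H _]]]]]. eapply has_size_finite; eauto. }
  apply finite_subset with (fun r => esep l r /\ exists z, Z z /\ mid r z).
  { apply finitely_many_eseps_meeting; auto. }
  intros r [Hr Hx]. split; auto. apply NNPP. intros N. apply Hx. clear Hx.
  assert (G : forall r, esep l r -> (forall z, Z z -> ~ mid r z) -> fst r x0 -> nested s r).
  { clear r Hr N. intros r Hr N H0. assert (Ir := esep_isep l r Hr).
    assert (D : forall x, mid s x -> ~ snd r x).
    { intros x Hx. apply (isep_same_side r (W x) x0 x Ir); auto; [apply HW|].
      intros z Hz. apply N. exists x. auto. }
    destruct (esep_mid_nonempty l r Hr) as [y Hy].
    destruct (esep_full_component l (inv r) (esep_inv adj l r Hr)) as [b Hb].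
    assert (C : forall a, snd r a -> reach adj (snd r) a b).
    { intros a Ha. apply (full_component_connects (inv r) b y a); auto.
      - apply isep_inv; auto.
      - rewrite mid_inv; auto. }
    assert (Fr : forall x, ~ snd r x -> fst r x).
    { intros x Hx. destruct (proj1 Ir x); tauto. }
    destruct (proj1 Is b) as [Hb'|Hb'].
    - assert (T : forall a, snd r a -> fst s a /\ ~ snd s a).
      { intros a Ha. apply (isep_same_side s (snd r) b a Is (reach_sym _ _ _ _ adj_sym (C a Ha))); auto.
        intros z Hz Hm. apply (D z Hm Hz). }
      apply nested_sym. right; right; left. split; simpl; intros a Ha; [apply T; auto|].
      apply Fr. intros H. apply (T a H). auto.
    - assert (T : forall a, snd r a -> snd s a /\ ~ fst s a).
      { intros a Ha. apply (isep_same_side (inv s) (snd r) b a (isep_inv adj adj_sym s Is)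
          (reach_sym _ _ _ _ adj_sym (C a Ha))); auto.
        intros z Hz. rewrite mid_inv. intros Hm. apply (D z Hm Hz). }
      apply nested_sym. right; right; right. split; simpl; intros a Ha; [apply T; auto|].
      apply Fr. intros H. apply (T a H). auto. }
  assert (N' : forall z, Z z -> ~ mid r z) by (intros z Hz Hm; apply N; eauto).
  destruct (proj1 (esep_isep l r Hr) x0) as [H|H].
  - apply G; auto.
  - apply nested_inv_r. apply G; auto.
    + apply esep_inv; auto.
    + intros z Hz. rewrite mid_inv. auto.
Qed.

End Components.

(** * The canonical nested set *)

Section NestedSet.
Context {V : Type} (adj : V -> V -> Prop).
Implicit Types s r t : sep V.
Implicit Types P Q : (V -> Prop) -> (V -> Prop) -> Prop.

Local Notation eff := (eff adj).
Local Notation esep := (esep adj).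

Definition crossing k s : sep V -> Prop := fun r => esep k r /\ ~ nested s r.

Definition cand (L : sep V -> Prop) k P Q s : Prop :=
  eff P Q k s /\ forall r, L r -> nested s r.

Definition chosen (L : sep V -> Prop) k s : Prop :=
  exists P Q, cand L k P Q s /\
    forall r n m, cand L k P Q r -> has_size (crossing k s) n -> has_size (crossing k r) m -> n <= m.

(* The elements of order below [k]: among the efficient distinguishers of order [k] of two given
   tangles that are nested with [level k], keep those crossing fewest efficient distinguishers
   of order [k]. *)
Fixpoint level k : sep V -> Prop :=
  match k with
  | 0 => fun _ => False
  | S k => fun s => level k s \/ chosen (level k) k s
  end.

Definition tree_set s : Prop := exists k, level k s.

Context (adj_sym : forall u v, adj u v -> adj v u).
Context (conn : forall u v, reach adj (fun _ => True) u v).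
Context (nbrs_finite : forall v, finite_set (adj v)).

Lemma crossing_inv k s : crossing k (inv s) = crossing k s.
Proof. apply set_ext. intros r. unfold crossing. rewrite nested_inv_l. tauto. Qed.

Lemma cand_inv L k P Q s : cand L k P Q s -> cand L k P Q (inv s).
Proof.
  intros [H1 H2]. split; [apply eff_inv; auto|]. intros r Hr. apply nested_inv_l. auto.
Qed.

Lemma chosen_inv L k s : chosen L k s -> chosen L k (inv s).
Proof.
  intros [P [Q [H1 H2]]]. exists P, Q. split; [apply cand_inv; auto|].
  intros r n m Hr. rewrite crossing_inv. apply H2; auto.
Qed.

Lemma level_inv k s : level k s -> level k (inv s).
Proof. induction k as [|k IH]; simpl; auto. intros [H|H]; auto using chosen_inv. Qed.

Lemma tree_set_inv s : tree_set s -> tree_set (inv s).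
Proof. intros [k H]. exists k. apply level_inv; auto. Qed.

Lemma level_esep k s : level k s -> exists l, l < k /\ esep l s.
Proof.
  induction k as [|k IH]; simpl; [tauto|]. intros [H|[P [Q [[H _] _]]]].
  - destruct (IH H) as [l [H1 H2]]. exists l. split; auto.
  - exists k. split; auto. exists P, Q. auto.
Qed.

Lemma tree_set_esep s : tree_set s -> exists l, esep l s.
Proof. intros [k H]. destruct (level_esep k s H) as [l [_ H']]. eauto. Qed.

Lemma level_mono k l s : k <= l -> level k s -> level l s.
Proof. induction 1; simpl; auto. Qed.

Lemma crossing_has_size k s : esep k s -> exists n, has_size (crossing k s) n.
Proof.
  intros H. apply finite_has_size. apply (finitely_many_crossing adj adj_sym conn nbrs_finite k k s H).
Qed.

(** A separation crossing one corner crosses [s] or [r], and one crossing both corners crosses both.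
    Strictness comes from [s] itself, which crosses [r] but neither corner. *)
Lemma opposite_corners_cross_less k s r a b c d :
  esep k s -> esep k r -> ~ nested s r ->
  has_size (crossing k s) a -> has_size (crossing k r) b ->
  has_size (crossing k (join s r)) c -> has_size (crossing k (join (inv s) (inv r))) d ->
  c + d < a + b.
Proof.
  intros Es Er N Ha Hb Hc Hd.
  assert (N' : ~ nested (inv s) (inv r)) by (rewrite nested_inv_l, nested_inv_r; auto).
  assert (J : forall t, nested s t -> nested r t -> nested (join s r) t).
  { intros t H1 H2. apply nested_sym, nested_join; auto; apply nested_sym; auto. }
  assert (J' : forall t, nested s t -> nested r t -> nested (join (inv s) (inv r)) t).
  { intros t H1 H2. apply nested_sym, nested_join; auto; apply nested_inv_r, nested_sym; auto. }
  apply (has_size_four_lt _ _ _ _ c d a b Hc Hd Ha Hb) with (x0 := s).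
  - intros t [H1 H2]. destruct (classic (nested s t)) as [H3|H3]; [right|left; split; auto].
    split; auto.
  - intros t [H1 H2]. destruct (classic (nested s t)) as [H3|H3]; [right|left; split; auto].
    split; auto.
  - intros t [H1 H2] [_ H3]. split; split; auto; intros H4; apply nested_sym in H4.
    + destruct (nested_opposite_joins s r t H4) as [H|H]; apply nested_sym in H; auto.
    + destruct (nested_opposite_joins_r s r t H4) as [H|H]; apply nested_sym in H; auto.
  - right. split; auto. intros H. apply N. apply nested_sym. auto.
  - intros [_ H]. apply H. apply nested_sym, nested_join_l.
  - intros [_ H]. apply H. apply nested_sym, nested_inv_l, nested_join_l.
Qed.

(** Suppose [s] and [r] cross, so that opposite corners satisfy [c + d < a + b]. In the first
    outcome of [opposite_corners] minimality gives [a <= c] and [b <= d]; in the second it gives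
    both [2 * a < a + b] and [2 * b < a + b]. *)
Lemma chosen_nested L k s r : chosen L k s -> chosen L k r -> nested s r.
Proof.
  intros [P [Q [Hs Ms]]] [P' [Q' [Hr Mr]]]. apply NNPP. intros N.
  assert (Es : esep k s) by (exists P, Q; apply Hs).
  assert (Er : esep k r) by (exists P', Q'; apply Hr).
  destruct (crossing_has_size k s Es) as [a Ha]. destruct (crossing_has_size k r Er) as [b Hb].
  assert (C : forall x y P1 Q1 P2 Q2, or_inv s x -> or_inv r y ->
    eff P1 Q1 k (join x y) -> eff P2 Q2 k (join (inv x) (inv y)) ->
    exists c d, cand L k P1 Q1 (join x y) /\ cand L k P2 Q2 (join (inv x) (inv y)) /\
      has_size (crossing k (join x y)) c /\ has_size (crossing k (join (inv x) (inv y))) d /\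
      c + d < a + b).
  { intros x y P1 Q1 P2 Q2 Hx Hy E1 E2.
    assert (Nx : ~ nested x y).
    { destruct Hx as [->| ->], Hy as [->| ->]; rewrite ?nested_inv_l, ?nested_inv_r; auto. }
    assert (Ex : esep k x) by (destruct Hx as [->| ->]; auto using esep_inv).
    assert (Ey : esep k y) by (destruct Hy as [->| ->]; auto using esep_inv).
    assert (Hax : has_size (crossing k x) a) by (destruct Hx as [->| ->]; rewrite ?crossing_inv; auto).
    assert (Hby : has_size (crossing k y) b) by (destruct Hy as [->| ->]; rewrite ?crossing_inv; auto).
    destruct (crossing_has_size k (join x y)) as [c Hc]; [exists P1, Q1; auto|].
    destruct (crossing_has_size k (join (inv x) (inv y))) as [d Hd]; [exists P2, Q2; auto|].
    assert (Lx : forall t, L t -> nested t x).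
    { intros t Ht. apply nested_sym. destruct Hx as [->| ->]; rewrite ?nested_inv_l; apply Hs; auto. }
    assert (Ly : forall t, L t -> nested t y).
    { intros t Ht. apply nested_sym. destruct Hy as [->| ->]; rewrite ?nested_inv_l; apply Hr; auto. }
    exists c, d. split; [|split; [|split; [auto|split; [auto|]]]].
    - split; auto. intros t Ht. apply nested_sym, nested_join; auto.
    - split; auto. intros t Ht. apply nested_sym, nested_join; auto.
      + rewrite nested_inv_l, nested_inv_r; auto.
      + apply nested_inv_r; auto.
      + apply nested_inv_r; auto.
    - apply (opposite_corners_cross_less k x y a b c d); auto. }
  destruct (opposite_corners adj adj_sym P Q P' Q' k s r (proj1 Hs) (proj1 Hr))
    as [[x [y [Hx [Hy [E1 E2]]]]]|[[x [y [Hx [Hy [E1 E2]]]]] [x' [y' [Hx' [Hy' [E1' E2']]]]]]].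
  - destruct (C x y P Q P' Q' Hx Hy E1 E2) as [c [d [C1 [C2 [Hc [Hd Hlt]]]]]].
    assert (A1 := Ms _ _ _ C1 Ha Hc). assert (A2 := Mr _ _ _ C2 Hb Hd). lia.
  - destruct (C x y P Q P Q Hx Hy E1 E2) as [c [d [C1 [C2 [Hc [Hd Hlt]]]]]].
    destruct (C x' y' P' Q' P' Q' Hx' Hy' E1' E2') as [c' [d' [C1' [C2' [Hc' [Hd' Hlt']]]]]].
    assert (A1 := Ms _ _ _ C1 Ha Hc). assert (A2 := Ms _ _ _ C2 Ha Hd).
    assert (A3 := Mr _ _ _ C1' Hb Hc'). assert (A4 := Mr _ _ _ C2' Hb Hd'). lia.
Qed.

Lemma level_nested k s r : level k s -> level k r -> nested s r.
Proof.
  revert s r. induction k as [|k IH]; simpl; [tauto|].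
  intros s r [Hs|Hs] [Hr|Hr]; auto.
  - destruct Hr as [P [Q [[_ H] _]]]. apply nested_sym; auto.
  - destruct Hs as [P [Q [[_ H] _]]]. auto.
  - eapply chosen_nested; eauto.
Qed.

Lemma tree_set_nested s r : tree_set s -> tree_set r -> nested s r.
Proof.
  intros [k Hk] [l Hl]. apply (level_nested (max k l)).
  - apply (level_mono k); auto. lia.
  - apply (level_mono l); auto. lia.
Qed.

Lemma level_crossing_finite k l s : esep k s -> finite_set (fun r => level l r /\ ~ nested s r).
Proof.
  intros Es. apply finite_subset with (fun r => exists m, m < l /\ (esep m r /\ ~ nested s r)).
  - apply finite_bounded_union.
    + exists (seq 0 l). intros x Hx. apply in_seq. lia.
    + intros m _. apply (finitely_many_crossing adj adj_sym conn nbrs_finite k m s Es).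
  - intros r [Hr N]. destruct (level_esep l r Hr) as [m [H1 H2]]. eauto.
Qed.

(** Among the efficient distinguishers, take one crossing fewest members of [level k]. If it crosses
    [t], some corner with [t] is again efficient and is nested with [t]; since the level is nested,
    that corner crosses nothing new. *)
Lemma cand_exists P Q k s : eff P Q k s -> exists r, cand (level k) k P Q r.
Proof.
  intros E0.
  assert (F : forall r, eff P Q k r -> exists n, has_size (fun t => level k t /\ ~ nested r t) n).
  { intros r Er. apply finite_has_size. apply (level_crossing_finite k k r). exists P, Q. auto. }
  destruct (F s E0) as [n0 H0].
  destruct (least_nat (fun n => exists r, eff P Q k r /\ has_size (fun t => level k t /\ ~ nested r t) n) n0)
    as [n [[r [Er Hn]] Hmin]]; [eauto|].
  exists r. split; auto. intros t Ht. apply NNPP. intros N.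
  destruct (level_esep k t Ht) as [l [Hl [P' [Q' Et]]]].
  destruct (corner_of_smaller adj adj_sym P Q P' Q' k l r t Er Et Hl) as [x [y [Hx [Hy Ec]]]].
  destruct (F _ Ec) as [m Hm].
  assert (n <= m) by (apply Hmin; eauto).
  assert (m + 0 < n + 0); [|lia].
  assert (Nxy : ~ nested x y).
  { destruct Hx as [->| ->], Hy as [->| ->]; rewrite ?nested_inv_l, ?nested_inv_r; auto. }
  apply (has_size_four_lt _ (fun _ => False) _ (fun _ => False) m 0 n 0 Hm (has_size_empty _ (fun _ H => H))
           Hn (has_size_empty _ (fun _ H => H))) with (x0 := t); try tauto.
  - intros w [Hw Nw]. left. split; auto. intros Hrw. apply Nw. apply nested_sym, nested_join; auto.
    + apply nested_sym. destruct Hx as [->| ->]; rewrite ?nested_inv_l; auto.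
    + assert (nested w t) by (apply (level_nested k); auto).
      destruct Hy as [->| ->]; rewrite ?nested_inv_r; auto.
  - intros [_ H1]. apply H1. apply nested_sym.
    destruct Hy as [->| ->]; [|apply nested_inv_l]; apply nested_join_r.
Qed.

Lemma tree_set_distinguishes P Q :
  tangle adj P -> tangle adj Q -> distinguishable P Q -> exists k s, tree_set s /\ eff P Q k s.
Proof.
  intros HP HQ D. destruct (distinguishable_eff adj P Q HP HQ D) as [k [s0 E0]].
  destruct (cand_exists P Q k s0 E0) as [s1 C1].
  assert (F : forall s, cand (level k) k P Q s -> exists n, has_size (crossing k s) n).
  { intros s Hs. apply crossing_has_size. exists P, Q. apply Hs. }
  destruct (F s1 C1) as [n1 H1].
  destruct (least_nat (fun n => exists s, cand (level k) k P Q s /\ has_size (crossing k s) n) n1)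
    as [n [[s [Cs Hn]] Hmin]]; [eauto|].
  exists k, s. split; [|apply Cs]. exists (S k). right. exists P, Q. split; auto.
  intros r a m Cr Ha Hm. replace a with n by (eapply has_size_unique; eauto). apply Hmin. eauto.
Qed.

End NestedSet.

(** * Hall's theorem for almost identical matchings *)

(* [A x z] says that [z] may be assigned to [x]. Outside the finite set [Y] the identity is
   allowed, so an assignment for [Y] changes the identity only at finitely many points, and
   alternating paths work although [X] may be infinite. *)
Section Hall.
Context {T : Type} (X Y : T -> Prop) (A : T -> T -> Prop).

(** A partial assignment encoded by a total function: its values on the unassigned set [U] are
    ignored. The list [L] bounds where it departs from the identity. *)
Definition valid (f : T -> T) (U : T -> Prop) (L : list T) : Prop :=
  (forall x, X x -> ~ U x -> A x (f x)) /\
  (forall x y, X x -> X y -> ~ U x -> ~ U y -> f x = f y -> x = y) /\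
  (forall x, X x -> ~ U x -> ~ In x L -> f x = x).

(** A step of an alternating path: [x] could take the target now held by [y]. *)
Definition alt (f : T -> T) (U : T -> Prop) (x y : T) : Prop := X y /\ ~ U y /\ A x (f y).

Definition upd (f : T -> T) (a b : T) : T -> T :=
  fun x => if excluded_middle_informative (x = a) then b else f x.

Lemma upd_eq f a b : upd f a b a = b.
Proof. unfold upd. destruct excluded_middle_informative; tauto. Qed.

Lemma upd_neq f a b x : x <> a -> upd f a b x = f x.
Proof. intros H. unfold upd. destruct excluded_middle_informative; tauto. Qed.

Lemma chain_mono_in {B} (R R' : B -> B -> Prop) x l :
  (forall a b, In b l -> R a b -> R' a b) -> chain R x l -> chain R' x l.
Proof.
  revert x. induction l as [|a l IH]; simpl; auto. intros x H [H1 H2]. split; auto.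
Qed.

(** Targets are shifted along the path: [y] takes that of [x1], which becomes the unassigned start
    of a shorter path, and the last element takes the free [z]. *)
Lemma augment l : forall f U L y z,
  valid f U L -> X y -> U y -> chain (alt f U) y l -> NoDup (y :: l) ->
  A (last l y) z -> (forall x, X x -> ~ U x -> f x <> z) ->
  exists f' L', valid f' (fun x => U x /\ x <> y) L'.
Proof.
  induction l as [|x1 l IH]; intros f U L y z [V1 [V2 V3]] Xy Uy Hc Hn Hz Hfree.
  - exists (upd f y z), (y :: L). split; [|split].
    + intros x Hx Ux. destruct (classic (x = y)) as [->|N]; [rewrite upd_eq; auto|].
      rewrite upd_neq by auto. apply V1; tauto.
    + intros x x' Hx Hx' Ux Ux'.
      destruct (classic (x = y)) as [->|N], (classic (x' = y)) as [->|N'];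
        rewrite ?upd_eq, ?upd_neq by auto; intros E.
      * auto.
      * exfalso. apply (Hfree x'); auto; tauto.
      * exfalso. apply (Hfree x); auto; tauto.
      * apply V2; tauto.
    + intros x Hx Ux Hin. simpl in Hin. rewrite upd_neq by intuition. apply V3; intuition.
  - destruct Hc as [[X1 [U1 A1]] Hc]. rewrite last_cons_default in Hz.
    inversion Hn as [|? ? N1 N2]; subst. inversion N2 as [|? ? N3 N4]; subst.
    assert (Nyx : y <> x1) by (intros ->; apply N1; simpl; auto).
    destruct (IH (upd f y (f x1)) (fun x => (U x /\ x <> y) \/ x = x1) (y :: L) x1 z)
      as [f' [L' Hv]]; auto.
    + split; [|split].
      * intros x Hx Ux. destruct (classic (x = y)) as [->|N]; [rewrite upd_eq; auto|].
        rewrite upd_neq by auto. apply V1; tauto.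
      * intros x x' Hx Hx' Ux Ux'.
        destruct (classic (x = y)) as [->|N], (classic (x' = y)) as [->|N'];
          rewrite ?upd_eq, ?upd_neq by auto; intros E.
        -- auto.
        -- exfalso. assert (x1 = x') by (apply V2; tauto). subst; tauto.
        -- exfalso. assert (x = x1) by (apply V2; tauto). subst; tauto.
        -- apply V2; tauto.
      * intros x Hx Ux Hin. simpl in Hin. rewrite upd_neq by intuition. apply V3; intuition.
    + eapply chain_mono_in; [|exact Hc]. intros a b Hb [Xb [Ub Ab]].
      assert (b <> y) by (intros ->; apply N1; simpl; auto).
      assert (b <> x1) by (intros ->; auto).
      split; auto. split; [tauto|]. rewrite upd_neq; auto.
    + intros x Hx Ux. destruct (classic (x = y)) as [->|N].
      * rewrite upd_eq. apply Hfree; auto.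
      * rewrite upd_neq by auto. apply Hfree; tauto.
    + exists f', L'. replace (fun x => U x /\ x <> y)
        with (fun x => ((U x /\ x <> y) \/ x = x1) /\ x <> x1); auto.
      apply set_ext. intros x. split; [tauto|]. intros [H1 H2]. split; auto.
      intros ->. auto.
Qed.

Context (HYX : forall x, Y x -> X x) (HY : finite_set Y).
Context (Hid : forall x, X x -> ~ Y x -> A x x).

Definition spill (W : T -> Prop) : T -> Prop := fun z => (exists x, W x /\ A x z) /\ ~ W z.

(** Hall's inequality with the part of [W] outside [Y] cancelled: those elements are targets of
    themselves, and for infinite [W] only the finite remainders can be compared. *)
Context (Hall : forall W a b, (forall x, W x -> X x) -> has_size (spill W) a ->
  has_size (fun x => W x /\ Y x) b -> b <= a).

(** If no augmenting path starts at [y], every target of the reachable set [W] is already held by an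
    assigned element of [W]. The sets [B] and [M] leave out elements held by themselves on both
    sides of the count, which makes it finite. *)
Lemma hall_step f U L y :
  valid f U L -> (forall x, U x -> Y x) -> U y ->
  exists f' L', valid f' (fun x => U x /\ x <> y) L'.
Proof.
  intros HV HU Uy. apply NNPP. intros N.
  set (W := fun x => reach (alt f U) (fun _ => True) y x).
  assert (WX : forall x, W x -> X x).
  { intros x Hx. assert (G : forall a, reach (alt f U) (fun _ => True) a x -> X a -> X x).
    { induction 1 as [|a b c _ [Hb _] _ IH]; auto. }
    apply (G y); auto. }
  assert (C : forall x z, W x -> A x z -> exists x', W x' /\ ~ U x' /\ f x' = z).
  { intros x z Hx Hz. destruct (classic (exists x', X x' /\ ~ U x' /\ f x' = z)) as [[x' [H1 [H2 H3]]]|N'].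
    - exists x'. split; auto. apply reach_trans with x; [exact Hx|].
      apply reach_edge; auto. split; auto. split; auto. rewrite H3; auto.
    - exfalso. apply N. apply reach_chain in Hx. destruct Hx as [l [H1 [H2 _]]].
      destruct (chain_shorten _ _ _ H1) as [l' [H3 [H4 [H5 _]]]].
      apply (augment l' f U L y z); auto.
      + rewrite H4, H2. auto.
      + intros w Xw Uw E. apply N'. eauto. }
  destruct HV as [V1 [V2 V3]].
  destruct (choice (fun z x' => (exists x, W x /\ A x z) -> W x' /\ ~ U x' /\ f x' = z)) as [g Hg].
  { intros z. destruct (classic (exists x, W x /\ A x z)) as [[x [H1 H2]]|N'].
    - destruct (C x z H1 H2) as [x' H]. exists x'. auto.
    - exists z. tauto. }
  set (B := fun x => W x /\ ~ Y x /\ In x L).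
  set (M := fun x => W x /\ ~ U x /\ (In x L \/ Y x)).
  assert (FL : finite_set (fun x => In x L \/ Y x))
    by (apply finite_union; auto; exists L; auto).
  destruct (finite_has_size B) as [nb Hb].
  { eapply finite_subset; [exact FL|]. unfold B; simpl; tauto. }
  destruct (finite_has_size M) as [nm Hm].
  { eapply finite_subset; [exact FL|]. unfold M; simpl; tauto. }
  destruct (finite_has_size (fun x => W x /\ Y x)) as [ny Hny].
  { eapply finite_subset; [exact HY|]. simpl; tauto. }
  destruct (finite_has_size (fun x => W x /\ Y x /\ ~ U x)) as [nu Hnu].
  { eapply finite_subset; [exact HY|]. simpl; tauto. }
  (* An element outside [L] holds itself, so it can hold neither a target outside [W] nor a member
     of [B]. *)
  assert (I1 : forall z, spill W z \/ B z -> M (g z)).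
  { intros z Hz. assert (Ez : exists x, W x /\ A x z).
    { destruct Hz as [[H _]|[H1 [H2 _]]]; auto. exists z. auto. }
    destruct (Hg z Ez) as [H1 [H2 H3]]. split; auto. split; auto. left.
    apply NNPP. intros Hin. assert (E := V3 (g z) (WX _ H1) H2 Hin). rewrite H3 in E.
    rewrite <- E in *. destruct Hz as [[_ H]|[_ [_ H]]]; auto. }
  assert (I2 : forall z z', spill W z \/ B z -> spill W z' \/ B z' -> g z = g z' -> z = z').
  { assert (G : forall z, spill W z \/ B z -> f (g z) = z).
    { intros z Hz. apply Hg. destruct Hz as [[H _]|[H1 [H2 _]]]; auto. exists z. auto. }
    intros z z' Hz Hz' E. rewrite <- (G z), <- (G z'), E; auto. }
  assert (FU : finite_set (fun z => spill W z \/ B z)).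
  { apply (finite_inj (fun z => spill W z \/ B z) M g); auto. eapply has_size_finite; eauto. }
  destruct (finite_has_size _ FU) as [n1 Hn1].
  destruct (finite_has_size (spill W)) as [na Ha].
  { eapply finite_subset; [exact FU|]. simpl; tauto. }
  assert (n1 <= nm) by (eapply has_size_inj; eauto).
  assert (na + nb <= n1 + 0).
  { apply (has_size_four (spill W) B (fun z => spill W z \/ B z) (fun _ => False));
      auto using has_size_empty.
    intros x [_ H1] [H2 _]. tauto. }
  assert (nm + 0 <= nb + nu).
  { apply (has_size_four M (fun _ => False) B (fun x => W x /\ Y x /\ ~ U x));
      auto using has_size_empty; try tauto.
    intros x [H1 [H2 H3]]. unfold B. destruct (classic (Y x)); tauto. }
  assert (nu + 0 < ny + 0).
  { apply (has_size_four_lt (fun x => W x /\ Y x /\ ~ U x) (fun _ => False)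
      (fun x => W x /\ Y x) (fun _ => False)) with y; auto using has_size_empty; try tauto.
    left. split; auto. apply reach_refl. auto. }
  assert (ny <= na) by (eapply Hall; eauto). lia.
Qed.

Lemma almost_identical_matching : exists f L, valid f (fun _ => False) L.
Proof.
  assert (G : forall n U f L, has_size U n -> (forall x, U x -> Y x) -> valid f U L ->
    exists f' L', valid f' (fun _ => False) L').
  { induction n as [|n IH]; intros U f L Hn HU HV.
    - exists f, L. replace (fun _ : T => False) with U; auto.
      apply set_ext. intros x. generalize (has_size_0 _ Hn x). tauto.
    - destruct (has_size_pos _ _ Hn) as [y Hy]; [lia|].
      destruct (hall_step f U L y HV HU Hy) as [f' [L' HV']].
      destruct (finite_has_size (fun x => U x /\ x <> y)) as [m Hm].
      { eapply finite_subset; [eapply has_size_finite, Hn|]. simpl; tauto. }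
      apply (IH (fun x => U x /\ x <> y) f' L'); auto; [|firstorder].
      destruct Hn as [l [H1 [H2 H3]]].
      apply H2 in Hy as Hy'. apply in_split in Hy'. destruct Hy' as [p [q ->]].
      exists (p ++ q). split; [eapply NoDup_remove_1; eauto|]. split.
      + intros x. rewrite H2. rewrite !in_app_iff. simpl.
        assert (Nq := NoDup_remove_2 _ _ _ H1). rewrite in_app_iff in Nq.
        split; [intros [[H|[H|H]] H']; auto; congruence|].
        intros H. split; [tauto|]. intros ->. tauto.
      + rewrite length_app in *. simpl in H3. lia. }
  destruct (finite_has_size Y HY) as [n Hn].
  (* The start is the identity with all of [Y] unassigned. *)
  apply (G n Y (fun x => x) []); auto. split; [|split]; auto.
Qed.

End Hall.

(** * Thick ends from directions *)

Section Thick.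
Context {V : Type} (adj : V -> V -> Prop).
Context (adj_sym : forall u v, adj u v -> adj v u).
Context (conn : forall u v, reach adj (fun _ => True) u v).
Context (nbrs_finite : forall v, finite_set (adj v)).
Context (v0 : V).
Implicit Types s r t : sep V.
Local Notation isep := (isep adj).

Fixpoint ball (m : nat) : V -> Prop :=
  match m with
  | 0 => fun x => x = v0
  | S m => fun x => ball m x \/ exists y, ball m y /\ adj y x
  end.

Lemma ball_finite m : finite_set (ball m).
Proof.
  induction m as [|m IH]; simpl.
  - exists [v0]. simpl; auto.
  - apply finite_union; auto. apply finite_nbrs; auto.
Qed.

Lemma ball_mono m n x : m <= n -> ball m x -> ball n x.
Proof. induction 1; simpl; auto. Qed.

Lemma ball_center m : ball m v0.
Proof. apply (ball_mono 0); [lia|reflexivity]. Qed.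

Lemma ball_exhausts x : exists m, ball m x.
Proof.
  assert (G : forall a, reach adj (fun _ => True) a x -> (exists m, ball m a) -> exists m, ball m x).
  { induction 1 as [|a b c _ Hab _ IH]; auto. intros [m Hm]. apply IH. exists (S m). right. eauto. }
  apply (G v0); auto. exists 0. reflexivity.
Qed.

Lemma finite_in_ball (S : V -> Prop) : finite_set S -> exists m, forall x, S x -> ball m x.
Proof.
  intros [l Hl]. assert (G : exists m, forall x, In x l -> ball m x).
  { clear Hl. induction l as [|a l [m IH]].
    - exists 0. intros x [].
    - destruct (ball_exhausts a) as [n Hn]. exists (max m n). intros x [<-|Hx].
      + eapply ball_mono; [|exact Hn]. lia.
      + eapply ball_mono; [|exact (IH x Hx)]. lia. }
  destruct G as [m Hm]. exists m. auto.
Qed.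

(** [O] is a direction: it orients all separations of finite order. By [O_connected], no fixed
    number of vertices separates all finite sets from its end, which is what will force infinitely
    many rays. *)
Context (O : (V -> Prop) -> (V -> Prop) -> Prop).
Context (O_isep : forall s, holds O s -> isep s /\ exists n, order s n).
Context (O_orients : forall s n, isep s -> order s n -> holds O s \/ holds O (inv s)).
Context (O_like : tangle_like O).
Context (O_down : forall s r n, holds O r -> le s r -> isep s -> order s n -> holds O s).
Context (O_connected : forall n, exists X, finite_set X /\
  forall s m, holds O s -> order s m -> (forall x, X x -> fst s x) -> n <= m).

Lemma O_join_not_full s r : holds O s -> holds O r -> (forall x, fst s x \/ fst r x) -> False.
Proof.
  intros Hs Hr Hf. apply (tl_full O O_like (join s r)); auto.
  apply tl_join; auto.
  destruct (O_isep s Hs) as [Is [a Ha]], (O_isep r Hr) as [Ir [b Hb]].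
  destruct (submodular s r a b Ha Hb) as [c [_ [Hc _]]].
  apply (O_orients _ c); auto. apply isep_join; auto.
Qed.

Lemma O_step m s : holds O s -> exists s',
  holds O s' /\ le s s' /\ (forall x, snd s' x -> ~ fst s x) /\
  (forall x y, snd s' x -> snd s' y -> reach adj (fun z => ~ ball m z) x y) /\
  (forall t a b, holds O t -> le s' t -> order s' a -> order t b -> a <= b).
Proof.
  intros Hs. destruct (O_isep s Hs) as [Is [n Hn]].
  set (S0 := fun z => mid s z \/ ball m z).
  set (S := fun z => S0 z \/ exists y, S0 y /\ adj y z).
  assert (FS0 : finite_set S0).
  { apply finite_union; [eapply has_size_finite; eauto|apply ball_finite]. }
  assert (FS : finite_set S) by (apply finite_union; auto; apply finite_nbrs; auto).
  destruct (finite_has_size S FS) as [k Hk].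
  assert (Sv : S v0) by (left; right; apply ball_center).
  destruct (tangle_like_component adj adj_sym conn nbrs_finite O S k v0 O_like Hk) as [x [Hx HK]]; auto.
  { intros r j Ir Hj _. eauto. }
  set (K := comp adj S x) in *.
  assert (KS : forall z, K z -> ~ S z) by (intros z; apply comp_out).
  assert (KN : forall u z, K u -> adj u z -> ~ S0 z).
  { intros u z Hu Huz Hz. apply (KS u Hu). right. exists z. auto. }
  assert (Kside : forall z, K z -> snd s z /\ ~ fst s z).
  { assert (Hxs : snd s x).
    { apply NNPP. intros N. apply (O_join_not_full (usep S K) s HK Hs). intros z. simpl.
      destruct (classic (K z)) as [Hz|Hz]; auto. right.
      apply (isep_same_side adj adj_sym s _ x z Is Hz); [intros w Hw Hm; apply Hw; left; left; auto|].
      destruct (proj1 Is x); tauto. }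
    intros z Hz. apply (isep_same_side adj adj_sym (inv s) _ x z (isep_inv adj adj_sym s Is) Hz); auto.
    intros w Hw. rewrite mid_inv. intros Hm. apply Hw. left; left; auto. }
  (* The separator consists only of neighbours of [K], so the big side is connected. *)
  set (t0 := (fun z => ~ K z, fun z => K z \/ exists u, K u /\ adj u z) : sep V).
  assert (It0 : isep t0).
  { apply isep_of_edges; simpl.
    - intros z. tauto.
    - intros u w Huw. assert (adj w u) by auto.
      destruct (classic (K u)), (classic (K w)); try tauto; right; split; eauto. }
  assert (Ft0 : finite_set (mid t0)).
  { eapply finite_subset; [exact FS|]. intros z [H1 [H2|[u [H2 H3]]]]; [destruct (H1 H2)|].
    apply NNPP. intros N. apply H1. eapply comp_closed; eauto. }
  destruct (finite_has_size _ Ft0) as [c Hc].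
  assert (Ot0 : holds O t0).
  { destruct (O_orients t0 c It0 Hc) as [H|H]; auto. exfalso.
    apply (O_join_not_full _ _ HK H). intros z. simpl. tauto. }
  assert (Da : forall z, snd t0 z -> ~ fst s z).
  { intros z [Hz|[u [Hu Huz]]]; [apply Kside; auto|]. intros Hf.
    destruct (isep_edge adj adj_sym s u z Is Huz) as [[H1 H2]|[H1 H2]].
    - apply (Kside u Hu); auto.
    - apply (KN u z Hu Huz). left. split; auto. }
  assert (Dball : forall z, snd t0 z -> ~ ball m z).
  { intros z [Hz|[u [Hu Huz]]] Hb; [apply (KS z Hz); left; right; auto|].
    apply (KN u z Hu Huz). right. auto. }
  assert (Dconn : forall z, snd t0 z -> reach adj (fun w => ~ ball m w) x z).
  { assert (DK : forall z, K z -> reach adj (fun w => ~ ball m w) x z).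
    { intros z Hz. eapply reach_mono; [|exact Hz]. simpl. intros w Hw Hb. apply Hw. left; right; auto. }
    intros z Hz. destruct Hz as [Hz|[u [Hu Huz]]]; auto.
    apply reach_trans with u; auto. apply reach_edge; auto; apply Dball; [left; auto|right; eauto]. }
  (* Least order above [t0] implies least order above [s']. The other properties survive because
     [snd s'] is contained in [snd t0]. *)
  destruct (least_nat (fun b => exists t, holds O t /\ le t0 t /\ order t b) c)
    as [b [[s' [O' [L' B']]] Hmin]].
  { exists t0. split; auto. split; auto. apply le_refl. }
  assert (Sn : forall z, snd s' z -> snd t0 z) by apply L'.
  exists s'. split; auto. split; [|split; [|split]].
  - apply le_trans with t0; auto. split; simpl.
    + intros z Hz HKz. apply (Kside z HKz); auto.
    + intros z Hz. assert (N := Da z Hz). destruct (proj1 Is z); tauto.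
  - auto.
  - intros y z Hy Hz. apply reach_trans with x; auto. apply reach_sym; auto.
  - intros t a d Ot Lt Ha Hd. replace a with b by (eapply has_size_unique; eauto).
    apply Hmin. exists t. split; auto. split; auto. apply le_trans with s'; auto.
Qed.

(** Menger's theorem as a matching problem: a vertex of [mid s] must move to a neighbour, any other
    vertex of the zone may stay. A violation of Hall's condition yields a member of [O] above [s] of
    smaller order. *)
Lemma zone_linkage s s' :
  holds O s -> holds O s' -> le s s' -> (forall x, snd s' x -> ~ fst s x) ->
  (forall t a b, holds O t -> le s t -> order s a -> order t b -> a <= b) ->
  exists f L, valid (fun x => snd s x /\ ~ snd s' x)
                    (fun x z => (z = x \/ adj x z) /\ ~ fst s z) f (fun _ => False) L.
Proof.
  intros Os Os' Hle Hdis Hmin. destruct (O_isep s Os) as [Is [n Hn]].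
  destruct (O_isep s' Os') as [Is' _].
  apply (almost_identical_matching _ (mid s)).
  - intros x [H1 H2]. split; auto. intros H3. apply (Hdis x H3 H1).
  - eapply has_size_finite; eauto.
  - intros x [H1 H2] H3. split; auto. intros H4. apply H3. split; auto.
  - intros W a b HW Ha Hb. destruct (le_lt_dec b a) as [|Hlt]; auto. exfalso.
    (* Moving [W] to the small side replaces the part of [mid s] inside [W] by [spill] of [W]. *)
    set (t := (fun z => fst s z \/ W z \/ exists u, W u /\ adj u z, fun z => snd s z /\ ~ W z) : sep V).
    assert (It : isep t).
    { apply isep_of_edges; simpl.
      - intros z. destruct (proj1 Is z); auto. destruct (classic (W z)); auto.
      - intros u w Huw. destruct (isep_edge adj adj_sym s u w Is Huw) as [H|H]; [tauto|].
        assert (adj w u) by auto.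
        destruct (classic (W u)), (classic (W w)); try tauto; left; split; eauto 6. }
    assert (Hmid : forall z, mid t z <-> (mid s z /\ ~ W z) \/ spill (fun x z => (z = x \/ adj x z) /\ ~ fst s z) W z).
    { intros z. unfold mid, sep_inter, spill. simpl. split.
      - intros [[H|[H|[u [H1 H2]]]] [H3 H4]]; try tauto.
        destruct (classic (fst s z)); [tauto|]. right. split; eauto.
      - intros [H|[[u [H1 [[->|H2] H3]]] H4]]; try tauto.
        split; [right; right; eauto|]. split; auto. destruct (proj1 Is z); tauto. }
    destruct (finite_has_size (fun z => mid s z /\ ~ W z)) as [e He].
    { eapply finite_subset; [eapply has_size_finite, Hn|]. simpl; tauto. }
    destruct (finite_has_size (mid t)) as [c Hc].
    { replace (mid t) with (fun z => (mid s z /\ ~ W z) \/ spill (fun x z => (z = x \/ adj x z) /\ ~ fst s z) W z).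
      - apply finite_union; eapply has_size_finite; eauto.
      - apply set_ext. intros z. rewrite Hmid. tauto. }
    assert (Lt : le t s').
    { split; simpl.
      - intros z [H|[H|[u [H1 H2]]]].
        + apply Hle; auto.
        + destruct (proj1 Is' z) as [|H3]; auto. destruct (HW z H); tauto.
        + destruct (isep_edge adj adj_sym s' u z Is' H2) as [|[H3 _]]; [tauto|].
          destruct (HW u H1); tauto.
      - intros z Hz. split; [apply Hle; auto|]. intros H. destruct (HW z H); tauto. }
    assert (Ot : holds O t) by (eapply O_down; eauto).
    assert (n <= c).
    { apply (Hmin t n c Ot); auto. split; simpl; [intros z; auto|intros z; tauto]. }
    assert (c + 0 <= e + a).
    { apply (has_size_four (mid t) (fun _ => False) _ _ c 0 e a Hc (has_size_empty _ (fun _ H => H)) He Ha);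
        try tauto. intros z Hz. apply Hmid; auto. }
    assert (e + b <= n + 0).
    { apply (has_size_four _ _ (mid s) (fun _ => False) e b n 0 He Hb Hn (has_size_empty _ (fun _ H => H)));
        tauto. }
    lia.
Qed.

Lemma separation_sequence : exists sq : nat -> sep V,
  (forall m, holds O (sq m)) /\ (forall m, le (sq m) (sq (S m))) /\
  (forall m x, snd (sq (S m)) x -> ~ fst (sq m) x) /\
  (forall m x y, snd (sq m) x -> snd (sq m) y -> reach adj (fun z => ~ ball m z) x y) /\
  (forall m t a b, holds O t -> le (sq m) t -> order (sq m) a -> order t b -> a <= b).
Proof.
  (* The pair [p] carries the radius of the ball to be avoided at this stage. *)
  destruct (choice (fun (p : nat * sep V) s' => holds O (snd p) ->
    holds O s' /\ le (snd p) s' /\ (forall x, snd s' x -> ~ fst (snd p) x) /\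
    (forall x y, snd s' x -> snd s' y -> reach adj (fun z => ~ ball (fst p) z) x y) /\
    (forall t a b, holds O t -> le s' t -> order s' a -> order t b -> a <= b))) as [F HF].
  { intros [m s]. simpl. destruct (classic (holds O s)) as [H|H].
    - destruct (O_step m s H) as [s' H']. exists s'. auto.
    - exists s. tauto. }
  set (e := (fun _ => False, fun _ => True) : sep V).
  assert (Oe : holds O e).
  { destruct (O_orients e 0) as [H|H]; auto.
    - apply isep_of_edges; simpl; auto.
    - apply has_size_empty. intros x [[] _].
    - exfalso. apply (tl_full O O_like _ H). simpl; auto. }
  set (sq := fix sq m := match m with 0 => F (0, e) | S m => F (S m, sq m) end).
  assert (HO : forall m, holds O (sq m)).
  { induction m as [|m IH]; simpl; [apply (HF (0, e)); auto|apply (HF (S m, sq m)); auto]. }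
  exists sq. split; auto.
  assert (G := fun m => HF (S m, sq m) (HO m)). simpl in G.
  split; [intros m; apply (G m)|]. split; [intros m; apply (G m)|].
  split; intros [|m]; [apply (HF (0, e)); auto|apply (G m)|apply (HF (0, e)); auto|apply (G m)].
Qed.

Lemma direction_thick_end : has_thick_end adj.
Proof.
  destruct separation_sequence as [sq [HO [Hle [Hdis [Hconn Hmin]]]]].
  assert (Mono : forall m n, m <= n -> le (sq m) (sq n)).
  { induction 1; [apply le_refl|]. eapply le_trans; eauto. }
  assert (Is : forall m, isep (sq m)) by (intros m; apply O_isep; auto).
  assert (Z : forall m, exists p : (V -> V) * list V,
     valid (fun x => snd (sq m) x /\ ~ snd (sq (S m)) x)
           (fun x z => (z = x \/ adj x z) /\ ~ fst (sq m) z) (fst p) (fun _ => False) (snd p)).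
  { intros m. destruct (zone_linkage _ _ (HO m) (HO (S m)) (Hle m) (Hdis m) (Hmin m)) as [f [L H]].
    exists (f, L). auto. }
  destruct (choice _ Z) as [ff Hff]. clear Z.
  set (W := snd (sq 0)).
  assert (Sball : forall m x, snd (sq m) x -> ~ ball m x).
  { intros m x Hx. apply (reach_source adj _ x x (Hconn m x x Hx Hx)). }
  (* The zones between consecutive separations partition [W], because the big sides leave every
     ball. *)
  set (lev := fun x m => snd (sq m) x /\ ~ snd (sq (S m)) x).
  assert (Hlev : forall x, W x -> exists m, lev x m).
  { intros x Hx. destruct (ball_exhausts x) as [m Hm].
    destruct (least_nat (fun m => ~ snd (sq m) x) m) as [[|k] [H1 H2]].
    - intros H. apply (Sball m x); auto.
    - exfalso. auto.
    - exists k. split; auto. apply NNPP. intros N. apply H2 in N. lia. }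
  assert (Lev_ge : forall x j m, lev x j -> snd (sq m) x -> m <= j).
  { intros x j m [_ H1] H2. destruct (le_lt_dec m j) as [|H]; auto. exfalso. apply H1.
    apply (Mono (S j) m); auto. }
  destruct (choice (fun x m => W x -> lev x m)) as [lv Hlv].
  { intros x. destruct (classic (W x)) as [H|H]; [|exists 0; tauto].
    destruct (Hlev x H) as [m Hm]. exists m. auto. }
  set (g := fun x => fst (ff (lv x)) x).
  assert (G1 : forall x, W x -> (g x = x \/ adj x (g x)) /\ ~ fst (sq (lv x)) (g x)).
  { intros x Hx. destruct (Hff (lv x)) as [H _]. apply H; [apply Hlv; auto|tauto]. }
  assert (G1' : forall x, W x -> fst (sq (S (lv x))) (g x)).
  { intros x Hx. destruct (Hlv x Hx) as [_ H1]. destruct (proj1 (G1 x Hx)) as [E|E].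
    - rewrite E. destruct (proj1 (Is (S (lv x))) x); tauto.
    - destruct (isep_edge adj adj_sym _ _ _ (Is (S (lv x))) E); tauto. }
  assert (G2 : forall m x, W x -> snd (sq m) x -> snd (sq m) (g x)).
  { intros m x Hx Hm. assert (m <= lv x) by (apply (Lev_ge x); auto; apply Hlv; auto).
    apply (Mono m (lv x)); auto. destruct (proj1 (Is (lv x)) (g x)) as [H'|H']; auto.
    exfalso. apply (G1 x Hx); auto. }
  assert (GW : forall x, W x -> W (g x)) by (intros x Hx; apply (G2 0); auto).
  assert (Ginj : forall x y, W x -> W y -> g x = g y -> x = y).
  { assert (Hlt : forall x y, W x -> W y -> g x = g y -> lv x < lv y -> False).
    { intros x y Hx Hy E Hl. apply (proj2 (G1 y Hy)). rewrite <- E.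
      apply (Mono (S (lv x)) (lv y)); auto. }
    intros x y Hx Hy E. destruct (lt_eq_lt_dec (lv x) (lv y)) as [[Hl|Hl]|Hl].
    - exfalso; eauto.
    - destruct (Hff (lv x)) as [_ [H _]]. apply H; auto.
      + apply Hlv; auto.
      + rewrite Hl. apply Hlv; auto.
      + unfold g in E. rewrite <- Hl in E. auto.
    - exfalso. apply (Hlt y x); auto. }
  assert (Gfix : forall x, W x -> ~ In x (snd (ff (lv x))) -> g x = x).
  { intros x Hx Hin. destruct (Hff (lv x)) as [_ [_ H]]. apply H; auto. apply Hlv; auto. }
  set (moved := fun m => flat_map (fun j => snd (ff j)) (seq 0 m)).
  assert (Hmoved : forall m x, W x -> ~ snd (sq m) x -> g x <> x -> In x (moved m)).
  { intros m x Hx Hm Hg. apply in_flat_map. exists (lv x). split.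
    - apply in_seq. split; [lia|]. destruct (le_lt_dec m (lv x)) as [H|H]; [|lia].
      exfalso. apply Hm. apply (Mono m (lv x)); auto. apply Hlv; auto.
    - apply NNPP. intros N. apply Hg. auto. }
  (* Since [g] is injective, the orbits of points without preimage are pairwise disjoint and meet no
     fixed point of [g]. *)
  set (start := fun w => W w /\ forall x, W x -> g x <> w).
  assert (IterW : forall n w, W w -> W (Nat.iter n g w)).
  { induction n; simpl; auto. }
  assert (Iter : forall n m w w', start w -> start w' -> Nat.iter n g w = Nat.iter m g w' -> n = m /\ w = w').
  { induction n as [|n IH]; intros [|m] w w' [H1 H2] [H3 H4] E; simpl in E; auto.
    - exfalso. apply (H2 (Nat.iter m g w')); auto.
    - exfalso. apply (H4 (Nat.iter n g w)); auto.
    - apply Ginj in E; auto. destruct (IH m w w') as [-> ->]; auto; split; auto. }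
  assert (Tail : forall w m, start w -> exists n, forall k, n <= k -> snd (sq m) (Nat.iter k g w)).
  { intros w m Hw.
    (* The injective orbit reaches a point outside the finite list of vertices moved below [sq m].
       Not being fixed, this point lies in [snd (sq m)], and by [G2] the orbit stays there. *)
    destruct (injective_sequence_escapes (fun n => Nat.iter n g w) (moved m)) as [n Hn].
    - intros i j E. apply (Iter i j w w Hw Hw E).
    - exists n. intros k Hk. induction Hk as [|k Hk IH]; simpl.
      + apply NNPP. intros N. apply Hn. apply Hmoved; auto; [apply IterW, Hw|].
        intros E. assert (S n = n) by (apply (Iter (S n) n w w Hw Hw); auto). lia.
      + apply G2; auto. apply IterW, Hw. }
  (* Each vertex of the separator of [sq m], and each vertex moved before it, is the image of a
     moved vertex or a starting point: so there are at least as many starting points as the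
     order of [sq m]. *)
  assert (Inf : ~ finite_set start).
  { intros F. destruct (finite_has_size _ F) as [q Hq].
    destruct (O_connected (S q)) as [X [FX HX]]. destruct (finite_in_ball X FX) as [m Hm].
    destruct (O_isep (sq m) (HO m)) as [_ [c Hc]].
    assert (S q <= c).
    { apply (HX (sq m)); auto. intros x Hx. destruct (proj1 (Is m) x) as [|H]; auto.
      exfalso. apply (Sball m x H). auto. }
    set (M := fun x => W x /\ ~ snd (sq m) x /\ g x <> x).
    assert (FM : finite_set M).
    { exists (moved m). intros x [H1 [H2 H3]]. auto. }
    destruct (finite_has_size M FM) as [nm Hnm].
    set (N := fun y => (mid (sq m) y \/ M y) /\ ~ start y).
    assert (MW : forall y, mid (sq m) y -> W y).
    { intros y [_ Hy]. apply (Mono 0 m); auto. lia. }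
    assert (NM : forall y, N y -> exists x, M x /\ g x = y).
    { intros y [Hy Ns].
      assert (Wy : W y) by (destruct Hy as [Hy|Hy]; [auto|apply Hy]).
      assert (Ex : exists x, W x /\ g x = y).
      { apply NNPP. intros E. apply Ns. split; auto. intros x Hx Hg. apply E. eauto. }
      destruct Ex as [x [Wx E]]. exists x. split; auto. split; auto.
      destruct Hy as [[Hf Hs]|[_ [Hs Hg]]].
      - assert (Nx : ~ snd (sq m) x).
        { intros Hx. apply (proj2 (G1 x Wx)). rewrite E.
          apply (Mono m (lv x)); auto. apply (Lev_ge x); auto. }
        split; auto. intros E'. apply Nx. congruence.
      - split.
        + intros Hx. apply Hs. rewrite <- E. apply G2; auto.
        + intros E'. apply Hg. congruence. }
    destruct (finite_has_size N) as [nn Hnn].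
    { eapply finite_subset; [apply finite_union; [eapply has_size_finite, Hc|exact FM]|].
      intros y [H1 _]. exact H1. }
    destruct (choice (fun y x => N y -> M x /\ g x = y)) as [h Hh].
    { intros y. destruct (classic (N y)) as [H'|H']; [|exists y; tauto].
      destruct (NM y H') as [x Hx]. eauto. }
    assert (nn <= nm).
    { apply (has_size_inj N M h); auto.
      - intros y Hy. apply Hh; auto.
      - intros y y' Hy Hy' E. destruct (Hh y Hy) as [_ <-], (Hh y' Hy') as [_ <-]. congruence. }
    assert (c + nm <= nn + q).
    { apply (has_size_four (mid (sq m)) M N start c nm nn q); auto.
      - intros y Hy. unfold N. destruct (classic (start y)); auto.
      - intros y Hy. unfold N. destruct (classic (start y)); auto.
      - intros y [_ H1] [_ [H2 _]]. tauto. }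
    lia. }
  destruct (infinite_sequence start Inf) as [w [Hw Winj]].
  assert (Ray : forall i, is_ray adj (fun n => Nat.iter n g (w i))).
  { intros i. split.
    - intros a b E. apply (Iter a b (w i) (w i)); auto.
    - intros n. simpl. destruct (proj1 (G1 (Nat.iter n g (w i)) ltac:(apply IterW, Hw))) as [E|E]; auto.
      exfalso. assert (S n = n) by (apply (Iter (S n) n (w i) (w i)); auto). lia. }
  exists (fun n => Nat.iter n g (w 0)). split; auto.
  exists (fun i n => Nat.iter n g (w i)). split; auto. split.
  - intros i S FS. destruct (finite_in_ball S FS) as [m Hm].
    destruct (Tail (w i) m (Hw i)) as [n1 H1]. destruct (Tail (w 0) m (Hw 0)) as [n2 H2].
    exists n1, n2. split; [|split].
    + intros k Hk HS. apply (Sball m _ (H1 k Hk)). auto.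
    + intros k Hk HS. apply (Sball m _ (H2 k Hk)). auto.
    + assert (R := Hconn m _ _ (H1 n1 (le_n _)) (H2 n2 (le_n _))). apply reach_chain in R.
      destruct R as [l [R1 [R2 R3]]]. exists l. split; auto. split; auto.
      intros x Hx HS. apply (R3 x Hx). auto.
  - intros i j Hij a b E. apply Hij. apply Winj. apply (Iter a b (w i) (w j)); auto.
Qed.

End Thick.

(** * Ascending chains *)

Section Chains.
Context {V : Type} (adj : V -> V -> Prop).
Context (adj_sym : forall u v, adj u v -> adj v u).
Context (conn : forall u v, reach adj (fun _ => True) u v).
Context (nbrs_finite : forall v, finite_set (adj v)).
Implicit Types s r t : sep V.
Implicit Types P Q : (V -> Prop) -> (V -> Prop) -> Prop.
Local Notation isep := (isep adj).
Local Notation orients := (orients adj).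
Local Notation eff := (eff adj).
Local Notation esep := (esep adj).
Local Notation tree_set := (tree_set adj).

Section NoMaximum.
(** A family violating the maximality condition. The vertices [u] and [v] may coincide; they are
    adjacent when an edge of the graph has to be placed in a bag. *)
Context (R : sep V -> Prop) (u v : V) (s0 : sep V).
Context (HR : forall s, R s -> tree_set s /\ snd s u /\ snd s v /\ ~ (fst s u /\ fst s v)).
Context (Rs0 : R s0).
Context (Hup : forall r, R r -> exists r', R r' /\ le r r' /\ r' <> r).

(** Members of the nested set outside [R] are included, so that a distinguisher found between two
    members of the chain again belongs to it. *)
Definition between r : Prop := tree_set r /\ le s0 r /\ exists r1, R r1 /\ le r r1.

Lemma between_ends r : between r -> snd r u /\ snd r v /\ ~ (fst r u /\ fst r v).
Proof.
  intros [_ [_ [r1 [H1 [H2 H3]]]]]. destruct (HR r1 H1) as [_ [A [B C]]].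
  split; auto. split; auto. intros [D E]. apply C. auto.
Qed.

Lemma between_esep r : between r -> exists k, esep k r.
Proof. intros [H _]. apply tree_set_esep; auto. Qed.

Lemma esep_unique k l r : esep k r -> esep l r -> k = l.
Proof.
  intros [P [Q [_ [_ [H _]]]]] [P' [Q' [_ [_ [H' _]]]]]. eapply has_size_unique; eauto.
Qed.

Lemma s0_not_small r : tree_set r -> le s0 r -> le s0 (inv r) -> False.
Proof.
  intros Hr H1 H2. destruct (HR s0 Rs0) as [H0 _].
  destruct (tree_set_esep adj s0 H0) as [k Hk]. destruct (tree_set_esep adj r Hr) as [l Hl].
  apply (esep_no_small adj adj_sym k s0 r); auto. eapply esep_isep; eauto.
Qed.

Lemma between_chain r r' : between r -> between r' -> le r r' \/ le r' r.
Proof.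
  intros B B'. destruct (between_ends r B) as [Ha [Hb _]]. destruct (between_ends r' B') as [_ [_ Hc]].
  destruct B as [T [L _]], B' as [T' [L' _]].
  destruct (tree_set_nested adj adj_sym conn nbrs_finite r r' T T') as [H|[H|[H|H]]]; auto.
  - exfalso. apply (s0_not_small r' T' L'). apply le_trans with r; auto.
  - exfalso. apply Hc. split; apply H; auto.
  - right. apply inv_le. auto.
Qed.

(** A fixed finite walk from a vertex of [fst s0] to [u] meets all these separators. *)
Lemma between_order_finite k : finite_set (fun r => between r /\ esep k r).
Proof.
  destruct (HR s0 Rs0) as [H0 _]. destruct (tree_set_esep adj s0 H0) as [l Hl].
  destruct (esep_proper adj adj_sym l s0 Hl) as [[a [Ha _]] _].
  destruct (reach_finite _ _ _ _ (conn a u)) as [Z [FZ [_ HZ]]].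
  eapply finite_subset; [apply (finitely_many_eseps_meeting adj adj_sym conn nbrs_finite k Z FZ)|].
  intros r [B E]. split; auto. apply (isep_walk_meets adj adj_sym r Z a u); auto.
  - eapply esep_isep; eauto.
  - apply B. auto.
  - apply between_ends; auto.
Qed.

Lemma between_above r : between r -> exists r', between r' /\ le r r' /\ r' <> r.
Proof.
  intros B. assert (B0 := B). destruct B as [T [L [r1 [R1 L1]]]].
  destruct (Hup r1 R1) as [r2 [R2 [L2 N]]]. exists r2.
  assert (L3 : le r r2) by (apply le_trans with r1; auto).
  split; [|split; auto].
  - split; [apply HR; auto|]. split; [apply le_trans with r; auto|]. exists r2. split; auto. apply le_refl.
  - intros ->. apply N. apply le_antisym; auto.
Qed.

(** Records mark the places after which the order has grown for good. *)
Definition record t k : Prop :=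
  between t /\ esep k t /\ forall r l, between r -> le t r -> r <> t -> esep l r -> k < l.

(** Take the least order occurring above [r], and a maximal element among the finitely many members
    of that order. *)
Lemma record_above r : between r -> exists t k, record t k /\ le r t.
Proof.
  intros B. destruct (between_esep r B) as [n Hn].
  destruct (least_nat (fun k => exists t, between t /\ le r t /\ esep k t) n) as [k [[t0 [B0 [L0 E0]]] Hmin]].
  { exists r. split; auto. split; auto. apply le_refl. }
  destruct (finite_maximal le (fun t => (between t /\ esep k t) /\ le r t) t0) as [t [[[Bt Et] Lt] Hmax]].
  - apply le_trans.
  - apply le_antisym.
  - eapply finite_subset; [apply (between_order_finite k)|]. simpl; tauto.
  - auto.
  - exists t, k. split; auto. split; auto. split; auto. intros r' l B' L' N E'.
    assert (Lr : le r r') by (apply le_trans with t; auto).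
    assert (k <= l) by (apply Hmin; eauto).
    destruct (Nat.eq_dec k l) as [<-|]; [|lia]. exfalso. apply N. apply Hmax; auto.
Qed.

Lemma record_next t k : record t k -> exists t' k', record t' k' /\ le t t' /\ t' <> t /\ k < k'.
Proof.
  intros [B [E H]]. destruct (between_above t B) as [r [Br [Lr Nr]]].
  destruct (record_above r Br) as [t' [k' [Rt' Lt']]].
  assert (L : le t t') by (apply le_trans with r; auto).
  assert (N : t' <> t) by (intros ->; apply Nr; apply le_antisym; auto).
  exists t', k'. split; auto. split; auto. split; auto. destruct Rt' as [B' [E' _]].
  apply (H t' k'); auto.
Qed.

Lemma record_unbounded n : exists t k, record t k /\ n < k.
Proof.
  induction n as [|n [t [k [Hr Hk]]]].
  - destruct (record_above s0) as [t [k [Hr _]]].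
    + split; [apply HR; auto|]. split; [apply le_refl|]. exists s0. split; auto. apply le_refl.
    + destruct (record_next t k Hr) as [t' [k' [H1 [_ [_ H2]]]]]. exists t', k'. split; auto. lia.
  - destruct (record_next t k Hr) as [t' [k' [H1 [_ [_ H2]]]]]. exists t', k'. split; auto. lia.
Qed.

(** * Tangles below the records and their limit *)

Definition record_tangle t k P : Prop :=
  record t k /\ exists Q, eff P Q k t /\ holds P (inv t) /\ holds Q t.

Lemma record_tangle_exists t k : record t k -> exists P, record_tangle t k P.
Proof.
  intros Hr. destruct (proj1 (proj2 Hr)) as [P [Q E]]. assert (E0 := E).
  destruct E as [_ [_ [_ [[[H1 H2]|[H1 H2]] _]]]].
  - exists Q. split; auto. exists P. split; auto. apply eff_sym; auto.
  - exists P. split; auto. exists Q. auto.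
Qed.

Lemma record_tangle_orients t k P : record_tangle t k P -> tangle adj P /\ orients P k.
Proof.
  intros [_ [Q [E _]]]. split; [apply E|]. apply (eff_orients adj P Q k t E).
Qed.

(** [Q'] contains [t] because it contains [t']. As [t] has order below [k'], it cannot distinguish
    [P'] from [Q']. *)
Lemma record_later t k P t' k' P' :
  record_tangle t k P -> record_tangle t' k' P' -> le t t' -> t' <> t -> holds P' t.
Proof.
  intros [R1 [Q [E [HP HQ]]]] [R2 [Q' [E' [HP' HQ']]]] L N.
  assert (Hk : k < k') by (destruct R1 as [_ [_ H]]; destruct R2 as [B2 [E2 _]]; apply (H t' k'); auto).
  destruct (eff_orients _ _ _ _ _ E') as [OP' OQ'].
  assert (It := eff_isep _ adj_sym _ _ _ _ E).
  destruct E as [_ [_ [Ht _]]]. destruct E' as [TP' [TQ' [_ [_ Hmin']]]].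
  assert (HQt : holds Q' t).
  { apply (tangle_down adj Q' t t'); auto. apply (OQ' t k); auto. lia. }
  destruct (OP' t k It Ht ltac:(lia)) as [H|H]; auto. exfalso.
  assert (k' <= k); [|lia]. apply (Hmin' t k); auto. right. auto.
Qed.

(* The distinguisher of [P] and [P'] in the nested set would lie between [t] and [t'],
   where all orders exceed [k]. *)
Lemma record_tangles_close t k P t' k' P' r m :
  record_tangle t k P -> record_tangle t' k' P' -> le t t' -> t' <> t ->
  dist P P' r -> order r m -> k <= m.
Proof.
  intros RT RT' L N Dr Hr. assert (Ht' := record_later _ _ _ _ _ _ RT RT' L N).
  destruct RT as [R1 [Q [E [HP HQ]]]], RT' as [R2 [Q' [E' [HP' HQ']]]].
  assert (Hk : k < k') by (destruct R1 as [_ [_ H]]; destruct R2 as [B2 [E2 _]]; apply (H t' k'); auto).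
  destruct (eff_orients _ _ _ _ _ E) as [OP OQ]. destruct (eff_orients _ _ _ _ _ E') as [OP' OQ'].
  assert (TP := proj1 E). assert (TP' := proj1 E').
  destruct (tree_set_distinguishes adj adj_sym conn nbrs_finite P P' TP TP') as [l [q [Tq Eq]]].
  { exists (fst r), (snd r). exact Dr. }
  assert (Hl : l <= m) by (eapply Eq; eauto).
  destruct (le_lt_dec k l) as [|Hlt]; [lia|]. exfalso.
  assert (Iq := eff_isep _ adj_sym _ _ _ _ Eq).
  assert (Oq : exists x, tree_set x /\ order x l /\ esep l x /\ isep x /\ holds P (inv x) /\ holds P' x).
  { assert (Eq' : esep l q) by (exists P, P'; auto).
    destruct Eq as [_ [_ [Ho [[[H1 H2]|[H1 H2]] _]]]].
    - exists (inv q). rewrite inv_inv. split; [apply tree_set_inv; auto|].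
      split; [apply order_inv; auto|]. split; [apply esep_inv; auto|]. split; [apply isep_inv; auto|]. auto.
    - exists q. auto 7. }
  clear q Tq Eq Iq. destruct Oq as [q [Tq [Hq [Eq [Iq [P1 P2]]]]]].
  destruct E as [_ [TQ [Ht [_ Hmin]]]]. destruct E' as [_ [TQ' [_ [_ Hmin']]]].
  (* Of order below [k] and [k'], the separation [q] distinguishes neither [P] from [Q] nor [P']
     from [Q']. *)
  assert (Q1 : holds Q (inv q)).
  { destruct (OQ q l Iq Hq ltac:(lia)) as [H|H]; auto. exfalso.
    assert (k <= l); [|lia]. apply (Hmin q l); auto. right. auto. }
  assert (Q2 : holds Q' q).
  { destruct (OQ' q l Iq Hq ltac:(lia)) as [H|H]; auto. exfalso.
    assert (k' <= l); [|lia]. apply (Hmin' q l); auto. left. auto. }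
  destruct R1 as [B1 [E1 H1]]. destruct R2 as [B2 [E2 _]].
  assert (It : isep t) by (eapply esep_isep; eauto).
  assert (T1 := proj1 B1). assert (T2 := proj1 B2).
  assert (OPq := OP q l Iq Hq ltac:(lia)). assert (OQq := OQ q l Iq Hq ltac:(lia)).
  assert (OPq' := OP' q l Iq Hq ltac:(lia)). assert (OQq' := OQ' q l Iq Hq ltac:(lia)).
  assert (OPt := OP t k It Ht (le_n _)).
  (* Each other nested position would put both orientations of [t] or of [q] into one of the
     tangles. *)
  assert (Ltq : le t q).
  { destruct (tree_set_nested adj adj_sym conn nbrs_finite t q T1 Tq) as [H|[H|[H|H]]]; auto; exfalso.
    - apply (tangle_not_both adj P t TP); auto. apply (tangle_down adj P t (inv q)); auto.
    - apply (tangle_not_both adj P' q TP'); auto. apply (tangle_down adj P' (inv q) t); auto.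
      apply le_inv_l; auto.
    - apply (tangle_not_both adj Q q TQ); auto. apply (tangle_down adj Q q t); auto.
      apply inv_le; auto. }
  assert (Lqt' : le q t').
  { destruct (tree_set_nested adj adj_sym conn nbrs_finite q t' Tq T2) as [H|[H|[H|H]]]; auto; exfalso.
    - apply (s0_not_small t' T2); [apply B2|]. apply le_trans with t; [apply B1|].
      apply le_trans with q; auto.
    - apply (tangle_not_both adj Q' q TQ'); auto. apply (tangle_down adj Q' (inv q) t'); auto.
    - apply (tangle_not_both adj P' t' TP'); auto. apply (tangle_down adj P' t' q); auto.
      apply inv_le; auto. }
  assert (Bq : between q).
  { split; auto. split; [apply le_trans with t; [apply B1|auto]|].
    destruct B2 as [_ [_ [r1 [Hr1 L1]]]]. exists r1. split; auto. apply le_trans with t'; auto. }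
  assert (k < l); [|lia]. apply (H1 q l); auto. intros ->.
  assert (k = l) by (eapply esep_unique; eauto). lia.
Qed.

Lemma record_tangles_agree_lt t k P t' k' P' s n :
  record_tangle t k P -> record_tangle t' k' P' -> le t t' -> t' <> t ->
  isep s -> order s n -> n < k -> (holds P s <-> holds P' s).
Proof.
  intros RT RT' L N Is Hs Hn.
  assert (Hk : k < k').
  { destruct RT as [[_ [_ H]] _]; destruct RT' as [[B2 [E2 _]] _]; apply (H t' k'); auto. }
  destruct (record_tangle_orients _ _ _ RT) as [TP OP].
  destruct (record_tangle_orients _ _ _ RT') as [TP' OP'].
  assert (C : dist P P' s -> False).
  { intros D. assert (k <= n) by (eapply (record_tangles_close t k P t' k' P' s); eauto). lia. }
  unfold dist in C.
  destruct (OP s n Is Hs ltac:(lia)), (OP' s n Is Hs ltac:(lia)); try tauto.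
Qed.

Lemma record_tangles_agree t k P t' k' P' s n :
  record_tangle t k P -> record_tangle t' k' P' ->
  isep s -> order s n -> n < k -> n < k' -> holds P s -> holds P' s.
Proof.
  intros RT RT' Is Hs Hn Hn' Ps.
  destruct (classic (t' = t)) as [->|N].
  (* Different tangles may belong to the same record; both are compared with a tangle of a later
     record. *)
  - destruct (record_next t k (proj1 RT)) as [t2 [k2 [R2 [L2 [N2 _]]]]].
    destruct (record_tangle_exists t2 k2 R2) as [P2 RT2].
    assert (A := record_tangles_agree_lt t k P t2 k2 P2 s n RT RT2 L2 N2 Is Hs Hn).
    assert (A' := record_tangles_agree_lt t k' P' t2 k2 P2 s n RT' RT2 L2 N2 Is Hs Hn').
    tauto.
  - destruct (between_chain t t') as [L|L]; [apply RT|apply RT'| |].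
    + apply (record_tangles_agree_lt t k P t' k' P' s n); auto.
    + apply (record_tangles_agree_lt t' k' P' t k P s n); auto.
Qed.

(** By [record_tangles_agree] it does not matter which record of order above [n] is consulted. *)
Definition limit_direction (A B : V -> Prop) : Prop :=
  exists t k P n, record_tangle t k P /\ is_separation adj A B /\
    has_size (sep_inter A B) n /\ n < k /\ P A B.

Lemma record_tangle_large n : exists t k P, record_tangle t k P /\ n < k.
Proof.
  destruct (record_unbounded n) as [t [k [H1 H2]]].
  destruct (record_tangle_exists t k H1) as [P HP]. eauto.
Qed.

Lemma limit_direction_holds s n t k P :
  holds limit_direction s -> order s n -> record_tangle t k P -> n < k -> holds P s.
Proof.
  intros [t' [k' [P' [n' [RT' [Is [Hn' [Hlt HP']]]]]]]] Hn RT Hk.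
  assert (n' = n) by (eapply has_size_unique; eauto). subst.
  eapply (record_tangles_agree t' k' P' t k P s n); eauto.
Qed.

Lemma limit_direction_intro s n t k P :
  isep s -> order s n -> record_tangle t k P -> n < k -> holds P s -> holds limit_direction s.
Proof. intros. exists t, k, P, n. auto 6. Qed.

Lemma no_maximum_thick_end : has_thick_end adj.
Proof.
  assert (Hsep : forall s, holds limit_direction s -> isep s /\ exists n, order s n).
  { intros s [t [k [P [n [_ [H1 [H2 _]]]]]]]. split; auto. exists n. auto. }
  assert (Hor : forall s n, isep s -> order s n ->
    holds limit_direction s \/ holds limit_direction (inv s)).
  { intros s n Is Hn. destruct (record_tangle_large n) as [t [k [P [RT Hlt]]]].
    destruct (record_tangle_orients _ _ _ RT) as [_ OP].
    destruct (OP s n Is Hn ltac:(lia)) as [H|H]; [left|right].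
    - eapply limit_direction_intro; eauto.
    - apply (limit_direction_intro (inv s) n t k P); auto; [apply isep_inv; auto|apply order_inv; auto]. }
  assert (Hjoin : forall s r, holds limit_direction s -> holds limit_direction r ->
    holds limit_direction (join s r)).
  { intros s r Ds Dr. destruct (Hsep s Ds) as [Is [a Ha]], (Hsep r Dr) as [Ir [b Hb]].
    destruct (submodular s r a b Ha Hb) as [c [d [Hc [_ Hcd]]]].
    destruct (record_tangle_large (a + b)) as [t [k [P [RT Hlt]]]].
    destruct (record_tangle_orients _ _ _ RT) as [TP OP].
    assert (Ij : isep (join s r)) by (apply isep_join; auto).
    apply (limit_direction_intro _ c t k P); auto; [lia|].
    apply (tangle_join adj adj_sym); auto.
    - apply (limit_direction_holds s a t k P); auto. lia.
    - apply (limit_direction_holds r b t k P); auto. lia.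
    - apply (OP _ c); auto. lia. }
  apply (direction_thick_end adj adj_sym conn nbrs_finite u limit_direction); auto.
  - split; auto. intros s Ds Hf. destruct (Hsep s Ds) as [Is [a Ha]].
    destruct (record_tangle_large a) as [t [k [P [RT Hlt]]]].
    destruct (record_tangle_orients _ _ _ RT) as [TP _].
    apply (tangle_not_full adj P s TP); auto. apply (limit_direction_holds s a t k P); auto.
  - intros s r n Dr L Is Hn. destruct (Hsep r Dr) as [Ir [b Hb]].
    destruct (record_tangle_large (n + b)) as [t [k [P [RT Hlt]]]].
    destruct (record_tangle_orients _ _ _ RT) as [TP OP].
    apply (limit_direction_intro _ n t k P); auto; [lia|].
    apply (tangle_down adj P s r); auto.
    + apply (limit_direction_holds r b t k P); auto. lia.
    + apply (OP s n); auto. lia.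
  (* The separator of a record [t] of order above [n] serves as [X]. If it lies in [fst s], then the
     separator of [join s t] is part of that of [s]. The direction contains [t] and hence this join,
     whereas the tangle [P] of the record contains [inv t] and hence the inverse of the join; at
     small order the two would agree. *)
  - intros n. destruct (record_tangle_large n) as [t [k [P [RT Hlt]]]].
    assert (Ht : order t k) by (destruct RT as [_ [Q [E _]]]; apply E).
    exists (mid t). split; [eapply has_size_finite; eauto|].
    intros s m Ds Hm Hsub. destruct (le_lt_dec n m) as [|Hlt']; auto. exfalso.
    assert (Dt : holds limit_direction t).
    { destruct (record_next t k (proj1 RT)) as [t2 [k2 [R2 [L2 [N2 Hk2]]]]].
      destruct (record_tangle_exists t2 k2 R2) as [P2 RT2].
      apply (limit_direction_intro t k t2 k2 P2); auto.
      - destruct RT as [_ [Q [E _]]]. eapply eff_isep; eauto.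
      - eapply record_later; eauto. }
    assert (Dj := Hjoin s t Ds Dt). destruct (Hsep _ Dj) as [Ij [c Hc]].
    assert (c <= m).
    { eapply has_size_subset; [exact Hc|exact Hm|]. intros x [[H1|H1] [H2 H3]]; split; auto.
      apply Hsub. split; auto. }
    destruct (record_tangle_orients _ _ _ RT) as [TP OP].
    apply (tangle_not_both adj P (join s t) TP).
    + apply (limit_direction_holds _ c t k P); auto. lia.
    + apply (tangle_down adj P (inv (join s t)) (inv t)); auto.
      * destruct RT as [_ [Q [_ [Hi _]]]]. auto.
      * apply le_inv. apply join_r.
      * rewrite inv_inv. destruct (OP _ c Ij Hc ltac:(lia)); auto.
Qed.

End NoMaximum.

Context (no_thick : ~ has_thick_end adj).

Lemma tree_set_maximal (R : sep V -> Prop) u v s0 :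
  (forall s, R s -> tree_set s /\ snd s u /\ snd s v /\ ~ (fst s u /\ fst s v)) -> R s0 ->
  exists m, R m /\ forall r, R r -> le m r -> r = m.
Proof.
  intros HR R0. apply NNPP. intros N. apply no_thick.
  apply (no_maximum_thick_end R u v s0 HR R0).
  intros r Hr. apply NNPP. intros N'. apply N. exists r. split; auto.
  intros r' Hr' L. apply NNPP. intros Ne. apply N'. eauto.
Qed.

End Chains.

(** * The tree of a nested set *)

Lemma chain_cut {X} (R : X -> X -> Prop) x l y :
  chain R x l -> NoDup (x :: l) -> In y (x :: l) ->
  exists Q1 Q2 : X -> Prop, reach R Q1 x y /\ reach R Q2 y (last l x) /\
    (forall z, Q2 z -> In z (x :: l)) /\ forall z, Q1 z -> Q2 z -> z = y.
Proof.
  revert x. induction l as [|a l IH]; intros x Hc Hn Hy.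
  - destruct Hy as [<-|[]]. exists (fun z => z = x), (fun z => z = x). simpl.
    split; [constructor; auto|]. split; [constructor; auto|]. split; intros; subst; auto.
  - destruct (classic (x = y)) as [<-|N].
    + exists (fun z => z = x), (fun z => In z (x :: a :: l)).
      split; [constructor; auto|]. split; [|split; auto].
      apply reach_chain. exists (a :: l). auto.
    + destruct Hy as [Hy|Hy]; [contradiction|]. destruct Hc as [Hxa Hc].
      inversion Hn as [|? ? N1 N2]; subst.
      destruct (IH a Hc N2 Hy) as [Q1 [Q2 [H1 [H2 [H3 H4]]]]].
      exists (fun z => z = x \/ Q1 z), Q2. split; [|split; [|split]].
      * apply reach_step with a; auto. eapply reach_mono; [|exact H1]. auto.
      * rewrite last_cons_default. auto.
      * intros z Hz. right. auto.
      * intros z [->|Hz] Hz2; auto. exfalso. apply N1. auto.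
Qed.

Section Tree.
Context {V : Type} (adj : V -> V -> Prop) (E : sep V -> Prop).
Implicit Types e f g h s r : sep V.

(* The orientation of [E] in which [e] points towards the node and is maximal. *)
Definition star e : sep V -> Prop :=
  fun f => E f /\ (le f e \/ (le f (inv e) /\ f <> inv e)).

(** The second alternative supplies the single node of the tree when [E] is empty. *)
Definition is_node (O : sep V -> Prop) : Prop :=
  (exists e, E e /\ O = star e) \/ ((forall e, ~ E e) /\ O = fun _ => False).

Definition node : Type := { O : sep V -> Prop | is_node O }.

Definition nadj (n m : node) : Prop :=
  exists e, E e /\ proj1_sig n = star e /\ proj1_sig m = star (inv e).

Definition nbag (n : node) (x : V) : Prop := forall s, proj1_sig n s -> snd s x.

Definition head e (He : E e) : node := exist is_node (star e) (or_introl (ex_intro _ e (conj He eq_refl))).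

Lemma node_ext (n m : node) : proj1_sig n = proj1_sig m -> n = m.
Proof.
  destruct n as [O H], m as [O' H']. simpl. intros ->. f_equal. apply proof_irrelevance.
Qed.

Context (E_isep : forall e, E e -> isep adj e).
Context (E_inv : forall e, E e -> E (inv e)).
Context (E_nested : forall e f, E e -> E f -> nested e f).
Context (E_proper : forall e, E e -> exists x, fst e x /\ ~ snd e x).
Context (E_max : forall (R : sep V -> Prop) u v s0,
  (forall s, R s -> E s /\ snd s u /\ snd s v /\ ~ (fst s u /\ fst s v)) -> R s0 ->
  exists m, R m /\ forall r, R r -> le m r -> r = m).

Lemma E_not_small e f : E e -> E f -> le e f -> le e (inv f) -> False.
Proof.
  intros He Hf [_ H1] [_ H2]. destruct (E_proper e He) as [x [Hx Hx']]. simpl in *.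
  destruct (proj1 (E_isep f Hf) x); auto.
Qed.

Lemma E_not_self e : E e -> ~ le e (inv e).
Proof. intros He H. apply (E_not_small e e); auto. apply le_refl. Qed.

Lemma star_self e : E e -> star e e.
Proof. intros He. split; auto. left. apply le_refl. Qed.

Lemma star_inv_self e : ~ star (inv e) e.
Proof.
  intros [He [H|[_ H]]]; [apply (E_not_self e He H)|]. apply H. rewrite inv_inv. auto.
Qed.

Lemma nadj_sym n m : nadj n m -> nadj m n.
Proof. intros [e [He [H1 H2]]]. exists (inv e). rewrite inv_inv. auto. Qed.

(** The stars of [e] and [inv e] differ only in the orientation of [e], so a step that loses [s]
    runs along the edge [s]. *)
Lemma nadj_lose n m s :
  nadj n m -> proj1_sig n s -> ~ proj1_sig m s -> proj1_sig n = star s /\ proj1_sig m = star (inv s).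
Proof.
  intros [e [He [H1 H2]]] Hn Hm. destruct (classic (s = e)) as [->|N]; auto. exfalso. apply Hm.
  rewrite H2. rewrite H1 in Hn. destruct Hn as [Hs [H|[H _]]].
  - split; auto. right. rewrite inv_inv. auto.
  - split; auto.
Qed.

Lemma reach_lose Q n m s :
  reach nadj Q n m -> proj1_sig n s -> ~ proj1_sig m s ->
  exists a b, Q a /\ Q b /\ proj1_sig a = star s /\ proj1_sig b = star (inv s).
Proof.
  intros H Hn Hm.
  destruct (reach_exit nadj Q (fun n => proj1_sig n s) n m H Hn Hm) as [a [b [H1 [H2 [H3 H4]]]]].
  apply reach_target in H1. destruct H1 as [H1 H5]. exists a, b. split; auto. split; auto.
  apply nadj_lose; auto.
Qed.

Lemma nadj_irrefl n : ~ nadj n n.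
Proof.
  intros [e [He [H1 H2]]]. apply (star_inv_self e). rewrite <- H2, H1. apply star_self; auto.
Qed.

(** The node [y] contains [inv e] and [x] does not. The rest of the cycle cannot lose [inv e]
    without visiting [x], so the closing edge loses it; but that edge would have to start at [y]. *)
Lemma nadj_acyclic : ~ (exists x l, chain nadj x l /\ NoDup (x :: l) /\ 2 <= length l /\ nadj (last l x) x).
Proof.
  intros [x [[|y l] [Hc [Hn [Hl Ha]]]]]; simpl in Hl; [lia|].
  destruct Hc as [[e [He [H1 H2]]] Hc]. rewrite last_cons_default in Ha.
  inversion Hn as [|? ? N1 N2]; subst. inversion N2 as [|? ? N3 N4]; subst.
  set (s := inv e) in *.
  assert (Hx : ~ proj1_sig x s).
  { rewrite H1. rewrite <- (inv_inv e). apply star_inv_self. }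
  assert (Hz : proj1_sig (last l y) s).
  { apply NNPP. intros N.
    destruct (reach_lose (fun z => In z (y :: l)) y (last l y) s) as [a [b [_ [Hb [_ H3]]]]]; auto.
    - apply reach_chain. exists l. auto.
    - rewrite H2. apply star_self. apply E_inv; auto.
    - apply N1. replace x with b; auto. apply node_ext. rewrite H3, H1. unfold s. rewrite inv_inv. auto. }
  destruct (nadj_lose _ _ s Ha Hz Hx) as [H3 _].
  apply N3. replace y with (last l y).
  - destruct l as [|a l]; [simpl in Hl; lia|].
    clear. revert a y. induction l as [|b l IH]; intros a y; [simpl; auto|].
    rewrite last_cons_default. right. apply IH.
  - apply node_ext. rewrite H2. auto.
Qed.

(** If [g] covers [e], they meet at one node. For [h] below [inv e], nestedness with [g] leaves two
    cases: [h] is below [inv g], or [inv h] is between [e] and [g], where covering forces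
    [inv h = g]. *)
Lemma star_cover_incl e g h :
  E e -> E g -> le e g -> e <> g -> (forall f, E f -> le e f -> le f g -> f = e \/ f = g) ->
  star e h -> star (inv g) h.
Proof.
  intros He Hg L N C [Hh H]. split; auto. rewrite inv_inv. destruct H as [H|[H Nh]].
  - right. split; [apply le_trans with e; auto|]. intros ->. apply N. apply le_antisym; auto.
  - assert (Leh : le e (inv h)) by (apply le_inv_r; auto).
    destruct (E_nested h g Hh Hg) as [H'|[H'|[H'|H']]]; auto.
    + right. split; auto. intros ->. apply (E_not_small e g); auto.
    + left. destruct (C (inv h)) as [H2|H2]; auto.
      * exfalso. apply Nh. rewrite <- H2, inv_inv. auto.
      * rewrite <- H2, inv_inv. apply le_refl.
    + exfalso. apply (E_not_small e h); auto. apply le_trans with g; auto. apply inv_le; auto.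
Qed.

Lemma star_cover e g :
  E e -> E g -> le e g -> e <> g -> (forall f, E f -> le e f -> le f g -> f = e \/ f = g) ->
  star e = star (inv g).
Proof.
  intros He Hg L N C. apply set_ext. intros h. split.
  - apply star_cover_incl; auto.
  - rewrite <- (inv_inv e). apply star_cover_incl; auto.
    + apply le_inv; auto.
    + intros H. apply N. rewrite <- (inv_inv e), <- H, inv_inv. auto.
    + intros f Hf L1 L2. destruct (C (inv f)) as [H|H]; auto.
      * apply le_inv_r; auto.
      * apply le_inv_l; auto.
      * right. rewrite <- H, inv_inv. auto.
      * left. rewrite <- H, inv_inv. auto.
Qed.

Lemma head_step e (He : E e) (He' : E (inv e)) : nadj (head e He) (head (inv e) He').
Proof. exists e. auto. Qed.

(** [E_max] takes the place of finiteness of the interval from [e] to [f]: applied upwards it gives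
    a maximal [g] whose head is reached, applied to inverses it gives a successor of [g] with
    adjacent head. Keeping the walk to nodes containing [e] is what later locates it on one side of
    a tree edge. *)
Lemma reach_le e f (He : E e) (Hf : E f) :
  le e f -> reach nadj (fun n => proj1_sig n e) (head e He) (head f Hf).
Proof.
  intros L.
  destruct (E_proper (inv f) (E_inv f Hf)) as [x [Hx Hx']]. simpl in *.
  destruct (E_max (fun g => E g /\ le e g /\ le g f /\
      exists Hg : E g, reach nadj (fun n => proj1_sig n e) (head e He) (head g Hg)) x x e)
    as [g [[Hg [L1 [L2 [Hg' Rg]]]] Gmax]].
  { intros s [Hs [L1 [L2 _]]]. split; auto. split; [apply L2; auto|]. split; [apply L2; auto|].
    intros [H _]. apply Hx'. apply L2; auto. }
  { split; auto. split; [apply le_refl|]. split; auto. exists He. constructor. apply star_self; auto. }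
  assert (Hfin : g = f).
  { apply NNPP. intros N.
    destruct (E_proper g Hg) as [y [Hy Hy']].
    destruct (E_max (fun k => E k /\ le k (inv g) /\ k <> inv g /\ le (inv f) k) y y (inv f))
      as [k [[Hk [K1 [K2 K3]]] Kmax]].
    { intros s [Hs [S1 [S2 S3]]]. split; auto. split; [apply S1; auto|]. split; [apply S1; auto|].
      intros [H _]. apply Hy'. apply S1 in H. auto. }
    { split; auto. split; [apply le_inv; auto|]. split; [|apply le_refl].
      intros H. apply N. rewrite <- (inv_inv g), <- H, inv_inv. auto. }
    assert (Hh : E (inv k)) by auto.
    assert (Lgh : le g (inv k)) by (apply le_inv_r; auto).
    assert (Ngh : g <> inv k) by (intros H; apply K2; rewrite H, inv_inv; auto).
    assert (Cov : star g = star (inv (inv k))).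
    { apply star_cover; auto. intros h Eh L3 L4.
      destruct (classic (h = g)) as [|Nh]; auto. right.
      assert (H : inv h = k).
      { apply Kmax.
        - split; auto. split; [apply le_inv; auto|]. split.
          + intros H. apply Nh. rewrite <- (inv_inv h), H, inv_inv. auto.
          + apply le_inv. apply le_trans with (inv k); auto. apply le_inv_l; auto.
        - apply le_inv_r; auto. }
      rewrite <- H, inv_inv. auto. }
    assert (Leh : le e (inv k)) by (apply le_trans with g; auto).
    apply Ngh. symmetry. apply Gmax; auto. split; auto. split; auto. split.
    - apply le_inv_l; auto.
    - exists Hh. apply reach_trans with (head g Hg'); auto.
      apply reach_edge.
      + simpl. split; auto.
      + simpl. split; auto.
      + apply nadj_sym. exists (inv k). simpl. auto. }
  subst g. replace (head f Hf) with (head f Hg'); auto. apply node_ext. auto.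
Qed.

Lemma node_cases (n : node) :
  (exists e (He : E e), n = head e He) \/ ((forall e, ~ E e) /\ proj1_sig n = fun _ => False).
Proof.
  destruct (proj2_sig n) as [[e [He H]]|H]; auto. left. exists e, He. apply node_ext. auto.
Qed.

Lemma nodes_connected n m : reach nadj (fun _ => True) n m.
Proof.
  assert (M : forall e f He Hf, le e f -> reach nadj (fun _ => True) (head e He) (head f Hf)).
  { intros e f He Hf L. eapply reach_mono; [|apply (reach_le e f He Hf L)]. auto. }
  assert (S : forall e He He', reach nadj (fun _ => True) (head e He) (head (inv e) He')).
  { intros e He He'. apply reach_edge; auto. apply head_step. }
  assert (S' : forall e He He', reach nadj (fun _ => True) (head (inv e) He') (head e He)).
  { intros e He He'. apply reach_edge; auto. apply nadj_sym, head_step. }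
  destruct (node_cases n) as [[e [He ->]]|[HE HO]], (node_cases m) as [[f [Hf ->]]|[HE' HO']].
  - destruct (E_nested e f He Hf) as [H|[H|[H|H]]]; auto.
    + apply reach_trans with (head (inv f) (E_inv f Hf)); auto.
    + apply reach_trans with (head (inv e) (E_inv e He)); auto.
    + apply reach_sym; [apply nadj_sym|]. apply M. apply inv_le; auto.
  - destruct (HE' e He).
  - destruct (HE f Hf).
  - replace m with n; [constructor; auto|]. apply node_ext. congruence.
Qed.

Lemma nadj_is_tree : is_tree nadj.
Proof.
  split; [apply nadj_sym|]. split; [apply nadj_irrefl|]. split; [|apply nadj_acyclic].
  intros n m. destruct (proj1 (reach_chain nadj _ n m) (nodes_connected n m)) as [l [H1 [H2 _]]].
  eauto.
Qed.

(** * Bags and the sides of tree edges *)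

Lemma bag_above e u v :
  E e -> snd e u -> snd e v ->
  (forall s, E s -> (fst s u /\ fst s v) \/ (snd s u /\ snd s v)) ->
  exists f (Hf : E f), le e f /\ nbag (head f Hf) u /\ nbag (head f Hf) v.
Proof.
  intros He Hu Hv Hsep.
  set (R := fun f => E f /\ le e f /\ snd f u /\ snd f v /\ ~ (fst f u /\ fst f v)).
  assert (F : exists f, E f /\ le e f /\ snd f u /\ snd f v /\ forall r, R r -> le f r -> r = f).
  { destruct (classic (exists f, R f)) as [[f0 Hf0]|N].
    - destruct (E_max R u v f0) as [f [Rf Hmax]]; auto.
      + intros s [H1 [_ H2]]. auto.
      + exists f. destruct Rf as [H1 [H2 [H3 [H4 _]]]]. auto 6.
    - exists e. split; auto. split; [apply le_refl|]. split; auto. split; auto.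
      intros r Hr. destruct N. eauto. }
  destruct F as [f [Hf [Lf [Fu [Fv Hmax]]]]]. exists f, Hf. split; auto.
  (* If [snd s] misses one of the vertices, both lie in [fst s], so [inv s] would be a member of [R]
     strictly above [f]. *)
  assert (B : forall s, star f s -> snd s u /\ snd s v).
  { intros s [Hs [L|[L N]]]; [split; apply L; auto|].
    destruct (classic (snd s u /\ snd s v)) as [|Ns]; auto. exfalso. apply N.
    assert (Lf' : le f (inv s)) by (apply le_inv_r; auto).
    rewrite <- (inv_inv s). f_equal. apply Hmax; auto.
    split; auto. split; [apply le_trans with f; auto|]. simpl.
    destruct (Hsep s Hs) as [[A1 A2]|]; tauto. }
  split; intros s Hs; apply B; auto.
Qed.

Lemma bag_exists u v :
  (forall s, E s -> (fst s u /\ fst s v) \/ (snd s u /\ snd s v)) -> exists n, nbag n u /\ nbag n v.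
Proof.
  intros Hsep. destruct (classic (exists e, E e)) as [[e He]|N].
  - assert (G : exists g, E g /\ snd g u /\ snd g v).
    { destruct (Hsep e He) as [H|H]; [exists (inv e)|exists e]; simpl; auto. }
    destruct G as [g [Hg [Gu Gv]]]. destruct (bag_above g u v Hg Gu Gv Hsep) as [f [Hf [_ H]]].
    eauto.
  - assert (HN : forall e, ~ E e) by eauto.
    exists (exist is_node (fun _ => False) (or_intror (conj HN eq_refl))).
    split; intros s [].
Qed.

Lemma nodes_tree_decomposition :
  (forall u v, adj u v -> adj v u) -> tree_decomposition adj nadj nbag.
Proof.
  intros adj_sym. split; [apply nadj_is_tree|]. split; [|split].
  - intros v. destruct (bag_exists v v) as [n [H _]]; eauto.
    intros s Hs. destruct (proj1 (E_isep s Hs) v); auto.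
  - intros u v Huv. apply bag_exists. intros s Hs. apply (isep_edge adj adj_sym); auto.
  - intros t1 t2 t3 [l [Hc [Hn [Hl Hin]]]] x [H1 H3] s Hs.
    destruct (classic (proj1_sig t1 s)) as [|N1]; [apply H1; auto|].
    destruct (classic (proj1_sig t3 s)) as [|N3]; [apply H3; auto|]. exfalso.
    (* Both parts of the path, read from [t2], lose [s] and hence visit [star (inv s)]. They share
       only [t2], which contains [s]. *)
    destruct (chain_cut nadj t1 l t2 Hc Hn Hin) as [Q1 [Q2 [R1 [R2 [_ HQ]]]]].
    rewrite Hl in R2. apply reach_sym in R1; [|apply nadj_sym].
    destruct (reach_lose _ _ _ s R1 Hs N1) as [a [b [_ [Qb [_ Eb]]]]].
    destruct (reach_lose _ _ _ s R2 Hs N3) as [c [d [_ [Qd [_ Ed]]]]].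
    assert (b = d) by (apply node_ext; congruence). subst d.
    assert (b = t2) by auto. subst b.
    apply (star_inv_self s). rewrite <- Ed. auto.
Qed.

(** Walks avoiding [head e] keep [inv e], so their bags lie in [fst e]. Conversely, [bag_above] and
    [reach_le] lead from [inv e] to a bag containing a given vertex of [fst e]. *)
Lemma edge_side_tail e (He : E e) (He' : E (inv e)) :
  edge_side nadj nbag (head (inv e) He') (head e He) = fst e.
Proof.
  apply set_ext. intros v. split.
  - intros [s [[l [Hc [Hl Hin]]] Hb]].
    assert (H : proj1_sig s (inv e)).
    { apply NNPP. intros N.
      destruct (reach_lose (fun z => In z (head (inv e) He' :: l)) (head (inv e) He') s (inv e))
        as [a [b [_ [Qb [_ Eb]]]]]; auto.
      - apply reach_chain. exists l. auto.
      - apply star_self; auto.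
      - apply Hin. replace (head e He) with b; auto. apply node_ext. rewrite Eb, inv_inv. auto. }
    apply (Hb (inv e) H).
  - intros Hv. destruct (bag_above (inv e) v v He' Hv Hv) as [f [Hf [L [Hb _]]]].
    { intros s Hs. destruct (proj1 (E_isep s Hs) v); auto. }
    exists (head f Hf). split; auto.
    destruct (proj1 (reach_chain nadj _ _ _) (reach_le (inv e) f He' Hf L)) as [l [H1 [H2 H3]]].
    exists l. split; auto. split; auto. intros Hin. apply H3 in Hin. simpl in Hin.
    apply (star_inv_self (inv e)). rewrite inv_inv. auto.
Qed.

Lemma edge_side_head e (He : E e) (He' : E (inv e)) :
  edge_side nadj nbag (head e He) (head (inv e) He') = snd e.
Proof.
  assert (He2 : E (inv (inv e))) by auto.
  replace (head e He) with (head (inv (inv e)) He2).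
  - apply (edge_side_tail (inv e) He').
  - apply node_ext. simpl. rewrite inv_inv. auto.
Qed.

End Tree.

(** * Canonicity *)

Section Canonical.
Context {V : Type} (adj : V -> V -> Prop).
Implicit Types s r : sep V.
Implicit Types P Q : (V -> Prop) -> (V -> Prop) -> Prop.

(* Automorphisms act by preimages, so that composition is respected definitionally. *)
Definition pre (phi : V -> V) s : sep V := (fun x => fst s (phi x), fun x => snd s (phi x)).
Definition pull (phi : V -> V) P : (V -> Prop) -> (V -> Prop) -> Prop :=
  fun A B => P (fun x => A (phi x)) (fun x => B (phi x)).

Lemma automorphism_inverse phi : graph_automorphism adj phi ->
  exists psi, graph_automorphism adj psi /\ (forall x, psi (phi x) = x) /\ (forall x, phi (psi x) = x).
Proof.
  intros [Hi [Hs Ha]]. destruct (choice (fun y x => phi x = y) Hs) as [psi Hpsi].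
  assert (H1 : forall x, psi (phi x) = x) by (intros x; apply Hi; auto).
  exists psi. split; auto. split; [|split].
  - intros x y E. rewrite <- (Hpsi x), <- (Hpsi y), E. auto.
  - intros y. exists (phi y). auto.
  - intros u v. rewrite (Ha (psi u) (psi v)), !Hpsi. tauto.
Qed.

Section Automorphism.
Context (phi psi : V -> V).
Context (Hphi : graph_automorphism adj phi).
Context (psi_phi : forall x, psi (phi x) = x) (phi_psi : forall x, phi (psi x) = x).

Lemma pre_psi s : pre phi (pre psi s) = s.
Proof.
  unfold pre. simpl. destruct s as [A B]. simpl.
  f_equal; apply functional_extensionality; intros x; rewrite psi_phi; auto.
Qed.

Lemma psi_pre s : pre psi (pre phi s) = s.
Proof.
  unfold pre. simpl. destruct s as [A B]. simpl.
  f_equal; apply functional_extensionality; intros x; rewrite phi_psi; auto.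
Qed.

Lemma pre_inj s r : pre phi s = pre phi r -> s = r.
Proof. intros H. rewrite <- (psi_pre s), <- (psi_pre r), H. auto. Qed.

Lemma forall_phi (Z : V -> Prop) : (forall x, Z (phi x)) -> forall x, Z x.
Proof. intros H x. rewrite <- (phi_psi x). auto. Qed.

Lemma pre_le s r : le (pre phi s) (pre phi r) <-> le s r.
Proof.
  split; intros [H1 H2]; split.
  - unfold subset. apply (forall_phi (fun x => fst s x -> fst r x)). exact H1.
  - unfold subset. apply (forall_phi (fun x => snd r x -> snd s x)). exact H2.
  - intros x. apply H1.
  - intros x. apply H2.
Qed.

Lemma pre_nested s r : nested (pre phi s) (pre phi r) <-> nested s r.
Proof.
  assert (I : forall s, inv (pre phi s) = pre phi (inv s)) by reflexivity.
  unfold nested. rewrite !I, !pre_le. tauto.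
Qed.

Lemma pre_has_size (Z : V -> Prop) n : has_size (fun x => Z (phi x)) n <-> has_size Z n.
Proof.
  split.
  - intros [l [H1 [H2 H3]]]. exists (map phi l). split; [|split].
    + apply Injective_map_NoDup; auto. intros x y. apply Hphi.
    + apply (forall_phi (fun x => Z x <-> In x (map phi l))). intros x. rewrite H2. split.
      * apply in_map.
      * intros H. apply in_map_iff in H. destruct H as [y [E Hy]].
        apply (proj1 Hphi) in E. subst. auto.
    + rewrite length_map. auto.
  - intros [l [H1 [H2 H3]]]. exists (map psi l). split; [|split].
    + apply Injective_map_NoDup; auto. intros x y E. rewrite <- (phi_psi x), <- (phi_psi y), E. auto.
    + intros x. rewrite H2. split.
      * intros H. rewrite <- (psi_phi x). apply in_map. auto.
      * intros H. apply in_map_iff in H. destruct H as [y [E Hy]]. subst. rewrite phi_psi. auto.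
    + rewrite length_map. auto.
Qed.

Lemma pre_isep s : isep adj (pre phi s) <-> isep adj s.
Proof.
  destruct Hphi as [_ [_ Ha]]. split; intros [H1 H2]; split.
  - apply (forall_phi (fun x => fst s x \/ snd s x)). exact H1.
  - apply (forall_phi (fun u => forall v, adj u v -> fst s u -> ~ snd s u -> snd s v -> ~ fst s v -> False)).
    intros u. apply (forall_phi (fun v => adj (phi u) v -> fst s (phi u) -> ~ snd s (phi u) ->
       snd s v -> ~ fst s v -> False)).
    intros v Huv. exact (H2 u v (proj2 (Ha u v) Huv)).
  - intros x. apply H1.
  - intros u v Huv. exact (H2 (phi u) (phi v) (proj1 (Ha u v) Huv)).
Qed.

Lemma pre_order s n : order (pre phi s) n <-> order s n.
Proof. apply (pre_has_size (mid s)). Qed.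

Lemma pull_tangle P : tangle adj P -> tangle adj (pull phi P).
Proof.
  assert (Hset : forall A B : V -> Prop, set_eq (fun x => A (phi x)) (fun x => B (phi x)) <-> set_eq A B).
  { intros A B. split; intros H; [exact (forall_phi (fun x => A x <-> B x) H)|].
    intros x. apply H. }
  assert (Hsub : forall A B : V -> Prop, subset A B -> subset (fun x => A (phi x)) (fun x => B (phi x))).
  { intros A B H x. apply H. }
  assert (Hord : forall A B k, order_lt (fun x => A (phi x)) (fun x => B (phi x)) k <-> order_lt A B k).
  { intros A B [k|]; simpl.
    - split; intros [m [H1 H2]]; exists m; split; auto; apply (pre_order (A, B)); auto.
    - split; intros H; apply finite_has_size in H; destruct H as [n Hn];
        apply has_size_finite with n; apply (pre_order (A, B)); auto. }
  intros [[k [H1 [H2 [H3 H4]]]] H5]. split.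
  - exists k. split; [|split; [|split]].
    + intros A B HP. destruct (H1 _ _ HP) as [Ha Hb]. split.
      * apply (pre_isep (A, B)); auto.
      * apply Hord; auto.
    + intros A B Hs Ho. apply H2; [apply (pre_isep (A, B)); auto|apply Hord; auto].
    + intros A B HP HP'. apply Hset. apply (H3 _ _ HP HP').
    + intros A B C D HP HQ N [S1 S2]. apply (H4 _ _ _ _ HP HQ); [|split; apply Hsub; auto].
      unfold sep_eq. rewrite !Hset. exact N.
  - intros A1 B1 A2 B2 A3 B3 P1 P2 P3 [C1 C2]. apply (H5 _ _ _ _ _ _ P1 P2 P3). split.
    + intros v. apply C1.
    + intros u v Huv. apply C2. exact (proj1 (proj2 (proj2 Hphi) u v) Huv).
Qed.

Lemma pull_eff P Q k s : eff adj P Q k (pre phi s) -> eff adj (pull phi P) (pull phi Q) k s.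
Proof.
  intros [HP [HQ [H1 [H2 H3]]]]. split; [apply pull_tangle; auto|]. split; [apply pull_tangle; auto|].
  split; [apply pre_order; auto|]. split; [exact H2|].
  intros r m Hr Hm. apply (H3 (pre phi r) m); [exact Hr|]. apply pre_order; auto.
Qed.

End Automorphism.

Lemma eff_pre phi psi P Q k s :
  graph_automorphism adj phi -> graph_automorphism adj psi ->
  (forall x, psi (phi x) = x) -> (forall x, phi (psi x) = x) ->
  eff adj P Q k s -> eff adj (pull psi P) (pull psi Q) k (pre phi s).
Proof.
  intros Hphi Hpsi H1 H2 He. apply (pull_eff psi phi); auto.
  rewrite (psi_pre phi psi); auto.
Qed.

(** Efficiency, nestedness and crossing numbers are transported by automorphisms, and every
    minimiser is chosen. The induction hypothesis is used for [phi] and for its inverse, so it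
    quantifies over both. *)
Lemma level_pre k : forall phi s, graph_automorphism adj phi -> level adj k s -> level adj k (pre phi s).
Proof.
  induction k as [|k IH]; intros phi s Hphi; simpl; auto. intros [H|[P [Q [[He Hn] Hmin]]]]; [left; auto|].
  right. destruct (automorphism_inverse phi Hphi) as [psi [Hpsi [E1 E2]]].
  assert (EP : forall P, pull phi (pull psi P) = P).
  { intros P'. apply functional_extensionality; intros A. apply functional_extensionality; intros B.
    unfold pull. f_equal; apply functional_extensionality; intros x; rewrite E2; auto. }
  exists (pull psi P), (pull psi Q).
  assert (Hcand : forall r, cand adj (level adj k) k (pull psi P) (pull psi Q) r ->
     cand adj (level adj k) k P Q (pre psi r)).
  { intros r [Hr Nr]. split.
    - apply (eff_pre psi phi) in Hr; auto. rewrite !EP in Hr; auto.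
    - intros q Hq. rewrite <- (psi_pre phi psi E2 q). apply (pre_nested psi phi); auto. }
  assert (Hcr : forall r n, has_size (crossing adj k (pre phi r)) n -> has_size (crossing adj k r) n).
  { intros r n [l [H1 [H2 H3]]]. exists (map (pre psi) l). split; [|split].
    - apply Injective_map_NoDup; auto. intros a b. apply (pre_inj psi phi); auto.
    - intros q. split.
      + intros [[P' [Q' Eq]] Nq]. apply in_map_iff. exists (pre phi q). split; [apply psi_pre; auto|].
        apply H2. split.
        * exists (pull psi P'), (pull psi Q'). apply eff_pre; auto.
        * rewrite (pre_nested phi psi); auto.
      + intros Hq. apply in_map_iff in Hq. destruct Hq as [q' [<- Hq]]. apply H2 in Hq.
        destruct Hq as [[P' [Q' Eq]] Nq]. split.
        * exists (pull phi P'), (pull phi Q'). apply eff_pre; auto.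
        * intros H. apply Nq. apply (pre_nested psi phi); auto. rewrite psi_pre; auto.
    - rewrite length_map. auto. }
  split; [split|].
  - apply eff_pre; auto.
  - intros q Hq. rewrite <- (pre_psi phi psi E1 q). apply (pre_nested phi psi); auto.
  - intros r n m Hr Hs Hm. apply (Hmin (pre psi r) n m); auto. apply Hcr. rewrite pre_psi; auto.
Qed.

Lemma tree_set_pre phi s : graph_automorphism adj phi -> (tree_set adj (pre phi s) <-> tree_set adj s).
Proof.
  intros Hphi. destruct (automorphism_inverse phi Hphi) as [psi [Hpsi [E1 E2]]]. split; intros [k Hk]; exists k.
  - rewrite <- (psi_pre phi psi E2 s). apply level_pre; auto.
  - apply level_pre; auto.
Qed.

(** * The action on the nodes *)

Context (E : sep V -> Prop).
Context (E_pre : forall phi s, graph_automorphism adj phi -> (E (pre phi s) <-> E s)).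

Definition act_set (phi : V -> V) (O : sep V -> Prop) : sep V -> Prop := fun s => O (pre phi s).

(** As [act_set] tests membership of [pre phi s], the edge [e] itself moves by the inverse [psi]. *)
Lemma act_star phi psi e : graph_automorphism adj phi ->
  (forall x, psi (phi x) = x) -> (forall x, phi (psi x) = x) ->
  act_set phi (star E e) = star E (pre psi e).
Proof.
  intros Hphi E1 E2. apply set_ext. intros s. unfold act_set, star.
  rewrite E_pre by auto.
  rewrite <- (pre_le phi psi E2 s (pre psi e)), <- (pre_le phi psi E2 s (inv (pre psi e))).
  change (inv (pre psi e)) with (pre psi (inv e)). rewrite !pre_psi by auto.
  assert (pre phi s = inv e <-> s = pre psi (inv e)).
  { split; [intros <-; rewrite psi_pre; auto|intros ->; apply pre_psi; auto]. }
  tauto.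
Qed.

Lemma act_is_node phi O : graph_automorphism adj phi -> is_node E O -> is_node E (act_set phi O).
Proof.
  intros Hphi. destruct (automorphism_inverse phi Hphi) as [psi [Hpsi [E1 E2]]].
  intros [[e [He ->]]|[HE ->]].
  - left. exists (pre psi e). split; [apply E_pre; auto|]. apply act_star; auto.
  - right. split; auto.
Qed.

(** The action in [td_canonical] is defined for every map; those that are not automorphisms act as
    the identity by default. *)
Definition act_node (phi : V -> V) (n : node E) : node E :=
  match excluded_middle_informative (graph_automorphism adj phi) with
  | left H => exist (is_node E) (act_set phi (proj1_sig n)) (act_is_node phi _ H (proj2_sig n))
  | right _ => n
  end.

Lemma act_node_val phi n : graph_automorphism adj phi ->
  proj1_sig (act_node phi n) = act_set phi (proj1_sig n).
Proof. intros H. unfold act_node. destruct excluded_middle_informative; tauto. Qed.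

Lemma automorphism_id : graph_automorphism adj (fun x => x).
Proof. split; [auto|]. split; [eauto|]. tauto. Qed.

Lemma automorphism_comp phi psi :
  graph_automorphism adj phi -> graph_automorphism adj psi -> graph_automorphism adj (fun x => phi (psi x)).
Proof.
  intros [A1 [A2 A3]] [B1 [B2 B3]]. split; [|split].
  - intros x y H. auto.
  - intros y. destruct (A2 y) as [x Hx], (B2 x) as [z Hz]. exists z. congruence.
  - intros u v. rewrite B3, A3. tauto.
Qed.

Lemma act_node_id n : act_node (fun x => x) n = n.
Proof.
  apply node_ext. rewrite act_node_val by apply automorphism_id.
  apply set_ext. intros [A B]. reflexivity.
Qed.

Lemma act_node_comp phi psi n :
  graph_automorphism adj phi -> graph_automorphism adj psi ->
  act_node (fun x => phi (psi x)) n = act_node phi (act_node psi n).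
Proof.
  intros H1 H2. apply node_ext. rewrite !act_node_val by auto using automorphism_comp. reflexivity.
Qed.

Lemma act_node_nadj phi n m :
  graph_automorphism adj phi -> nadj E n m -> nadj E (act_node phi n) (act_node phi m).
Proof.
  intros Hphi [e [He [H1 H2]]].
  destruct (automorphism_inverse phi Hphi) as [psi [Hpsi [E1 E2]]].
  exists (pre psi e). split; [apply E_pre; auto|].
  rewrite !act_node_val, H1, H2 by auto. split; [|change (inv (pre psi e)) with (pre psi (inv e))];
    apply act_star; auto.
Qed.

Lemma nodes_canonical : td_canonical adj (nadj E) (nbag E).
Proof.
  exists act_node. split; [|split; [apply act_node_id|intros; apply act_node_comp; auto]].
  intros phi Hphi. destruct (automorphism_inverse phi Hphi) as [psi [Hpsi [E1 E2]]].
  assert (F1 : (fun x => psi (phi x)) = fun x => x) by (apply functional_extensionality; auto).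
  assert (F2 : (fun x => phi (psi x)) = fun x => x) by (apply functional_extensionality; auto).
  assert (C1 : forall n, act_node psi (act_node phi n) = n).
  { intros n. rewrite <- act_node_comp, F1 by auto. apply act_node_id. }
  assert (C2 : forall n, act_node phi (act_node psi n) = n).
  { intros n. rewrite <- act_node_comp, F2 by auto. apply act_node_id. }
  split; [split; [|split]|].
  - intros x y H. rewrite <- (C1 x), <- (C1 y), H. auto.
  - intros y. eauto.
  - intros s t. split; intros H; [apply act_node_nadj; auto|].
    rewrite <- (C1 s), <- (C1 t). apply act_node_nadj; auto.
  - intros t v. unfold nbag. rewrite act_node_val by auto. unfold act_set. split; intros H s Hs.
    + apply (H (pre phi s) Hs).
    + specialize (H (pre psi s)). rewrite pre_psi in H by auto. simpl in H.
      rewrite E1 in H. auto.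
Qed.

End Canonical.

Theorem theorem1 :
  forall (V : Type) (adj : V -> V -> Prop),
    simple_graph adj ->
    connected_graph adj ->
    locally_finite adj ->
    ~ has_thick_end adj ->
    exists (N : Type) (tadj : N -> N -> Prop) (bag : N -> V -> Prop),
      tree_decomposition adj tadj bag /\
      td_canonical adj tadj bag /\
      td_efficiently_distinguishes_all_tangles adj tadj bag.
Proof.
  intros V adj [adj_sym _] [_ Hconn] Hlf Hnt.
  assert (conn : forall u v, reach adj (fun _ => True) u v).
  { intros u v. apply reach_chain. destruct (Hconn u v) as [l [H1 H2]]. eauto. }
  assert (nbrs_finite : forall v, finite_set (adj v)) by exact Hlf.
  set (E := tree_set adj).
  assert (E_isep : forall e, E e -> isep adj e).
  { intros e He. destruct (tree_set_esep adj e He) as [k Hk]. eapply esep_isep; eauto. }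
  assert (E_inv : forall e, E e -> E (inv e)) by apply tree_set_inv.
  assert (E_nested : forall e f, E e -> E f -> nested e f).
  { intros e f. apply tree_set_nested; auto. }
  assert (E_proper : forall e, E e -> exists x, fst e x /\ ~ snd e x).
  { intros e He. destruct (tree_set_esep adj e He) as [k Hk].
    apply (esep_proper adj adj_sym k e Hk). }
  assert (E_max : forall (R : sep V -> Prop) u v s0,
    (forall s, R s -> E s /\ snd s u /\ snd s v /\ ~ (fst s u /\ fst s v)) -> R s0 ->
    exists m, R m /\ forall r, R r -> le m r -> r = m).
  { intros R u v s0. apply tree_set_maximal; auto. }
  exists (node E), (nadj E), (nbag E). split; [|split].
  - apply nodes_tree_decomposition; auto.
  - apply nodes_canonical. intros phi s. apply tree_set_pre.
  - intros P Q HP HQ D.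
    destruct (tree_set_distinguishes adj adj_sym conn nbrs_finite P Q HP HQ D) as [k [e [He Heff]]].
    change (E e) in He. assert (He' := E_inv e He).
    (* Naming the tail of [e] first makes the two sides [fst e] and [snd e], in this order. *)
    exists (head E (inv e) He'), (head E e He). split.
    + exists (inv e). simpl. rewrite inv_inv. auto.
    + rewrite (edge_side_tail adj E E_isep E_inv E_nested E_proper E_max e He He'),
        (edge_side_head adj E E_isep E_inv E_nested E_proper E_max e He He').
      apply (eff_efficient adj P Q k e Heff).
Qed.
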